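(* Let $m\ge 3$ and let $R_m$ be a ring of butterflies with $m$ links. Then every hinge of $R_m$ is an implied nonedge of $R_m$. Furthermore: if $m\ge 7$ then $R_m$ is nucleation-free; if $m\ge 6$ then $R_m$ is independent and has exactly $m-6$ independent flexes; and if $m\le 5$ then $R_m$ is dependent.
   Context: All graphs are finite and simple. Rank, independence, rigidity and circuits refer to the 3-dimensional generic rigidity matroid $\mathcal{R}_3$ on the edge set of the complete graph on the relevant vertex set; $\mathrm{rank}(G)$ is the rank of $E(G)$. A graph $G$ is independent if $\mathrm{rank}(G)=|E(G)|$ and dependent otherwise; it is rigid if $\mathrm{rank}(G)$ equals the rank of the complete graph on $V(G)$ (which is $3|V(G)|-6$ when $|V(G)|\ge 3$), and flexible otherwise. The number of independent flexes of $G$ is $3|V(G)|-6-\mathrm{rank}(G)$. For a set $F$ of vertex pairs, $G\cup F$ denotes $G$ with the pairs of $F$ having both endpoints in $V(G)$ added as edges. A nonedge $f$ of $G$ (a pair of distinct non-adjacent vertices) is implied if $G\cup f$ contains a circuit containing $f$. A nucleation of $G$ is a rigid subgraph of $G$ on at least $5$ vertices; $G$ is nucleation-free if it has no nucleation. Ring: given $m\ge 3$ vertex-disjoint graphs $G_1,\dots,G_m$ (links), each with four distinct designated hinge vertices $a_i,b_i,c_i,d_i$, the ring $R(G_1,\dots,G_m)$ is obtained by identifying $a_1$ with $c_m$, $b_1$ with $d_m$, and, for $1\le i\le m-1$, $c_i$ with $a_{i+1}$ and $d_i$ with $b_{i+1}$. The pairs $(a_i,b_i)$ and $(c_i,d_i)$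 are the hinges. A butterfly is the graph obtained from $K_5$ by deleting two non-incident edges; a ring of butterflies is a ring whose links are all butterflies, where in each link the two hinges $(a_i,b_i)$ and $(c_i,d_i)$ are the two deleted edges (so the hinges are nonedges). *)

(* Defs.v *)
From HB Require Import structures.
From mathcomp Require Import all_boot all_order all_algebra.
From mathcomp Require Import reals.
From mathcomp.multinomials Require Import (canonicals) mpoly.

Set Implicit Arguments.
Unset Strict Implicit.
Unset Printing Implicit Defensive.

Import Order.TTheory GRing.Theory Num.Theory.
Local Open Scope ring_scope.

Record sgraph := SGraph {
  vertex :> finType;
  adj : rel vertex;
  adj_sym : symmetric adj;
  adj_irrefl : irreflexive adj
}.

Definition edges (G : sgraph) : {set {set G}} :=
  [set e | [exists u : G, exists v : G, adj u v && (e == [set u; v])]].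

Definition complete_edges (V : finType) (W : {set V}) : {set {set V}} :=
  [set e : {set V} | (e \subset W) && (#|e| == 2%N)].

Section Rigidity.
Variables (R : realType) (V : finType).
Implicit Types (p : V -> 'rV[R]_3) (F C : {set {set V}}).

(* The 3|V| coordinates of p are algebraically independent over the rationals. *)
Definition generic p : Prop :=
  forall P : mpoly.mpoly #|{: V * 'I_3}| rat,
    P != 0 ->
    mpoly.mmap ratr (fun k => p (enum_val k).1 0 (enum_val k).2) P != 0.

(* The row of the rigidity matrix indexed by the pair e = {u, v}, laid out as a
   |V| x 3 array: p u - p v at u, p v - p u at v, and 0 at the other vertices.
   A vertex contributes 0 against itself, so no orientation of e is needed. *)
Definition rigidity_row p (e : {set V}) : 'M[R]_(#|V|, 3) :=
  \matrix_(k < #|V|)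
    (if enum_val k \in e then \sum_(u in e) (p (enum_val k) - p u) else 0).

Definition rigidity_matrix p F : 'M[R]_(#|F|, #|V| * 3) :=
  \matrix_(k < #|F|) mxvec (rigidity_row p (enum_val k)).

(* For p generic, the rank of F in the rigidity matroid; it is meant for sets F
   of 2-element subsets of V, and does not depend on the generic p. *)
Definition rank3 p F : nat := \rank (rigidity_matrix p F).

Definition independent3 p F : Prop := rank3 p F = #|F|.

Definition dependent3 p F : Prop := ~ independent3 p F.

Definition circuit3 p C : Prop :=
  dependent3 p C /\ forall D : {set {set V}}, D \proper C -> independent3 p D.

End Rigidity.

Section GraphRigidity.
Variables (R : realType) (G : sgraph).
Implicit Type p : G -> 'rV[R]_3.

Definition implied_nonedge p (u v : G) : Prop :=
  [/\ u != v, ~~ adj u v &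
      exists C : {set {set G}},
        [/\ C \subset edges G :|: [set [set u; v]], [set u; v] \in C
          & circuit3 p C]].

Definition rigid_subgraph p (W : {set G}) (F : {set {set G}}) : Prop :=
  F \subset edges G :&: complete_edges W /\
  rank3 p F = rank3 p (complete_edges W).

Definition nucleation p (W : {set G}) (F : {set {set G}}) : Prop :=
  rigid_subgraph p W F /\ (5 <= #|W|)%N.

Definition nucleation_free p : Prop := forall W F, ~ nucleation p W F.

(* An integer, so that the subtraction is not truncated. *)
Definition independent_flexes p : int :=
  3 * #|G|%:Z - 6 - (rank3 p (edges G))%:Z.

End GraphRigidity.

Record link := Link {
  link_graph :> sgraph;
  hinge_a : link_graph;
  hinge_b : link_graph;
  hinge_c : link_graph;
  hinge_d : link_graph;
  hinges_uniq : uniq [:: hinge_a; hinge_b; hinge_c; hinge_d]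
}.

Definition is_butterfly (L : link) : Prop :=
  #|L| = 5%N /\
  forall x y : L,
    adj x y = [&& x != y,
                  [set x; y] != [set hinge_a L; hinge_b L]
                & [set x; y] != [set hinge_c L; hinge_d L]].

Section Ring.
Variables (m : nat) (L : 'I_m -> link).

(* The disjoint union of the vertex sets of the links. *)
Definition link_vertex : finType := {i : 'I_m & L i}.

Definition in_link (i : 'I_m) (x : L i) : link_vertex := Tagged (fun i => L i) x.

(* ordS is the cyclic successor on 'I_m. *)
Definition glue : rel link_vertex := fun x y =>
  [exists i : 'I_m,
     (x == in_link (hinge_c (L i))) && (y == in_link (hinge_a (L (ordS i))))
  || (x == in_link (hinge_d (L i))) && (y == in_link (hinge_b (L (ordS i))))].

Definition glue_class (x : link_vertex) : {set link_vertex} :=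
  [set y | connect (relU glue (fun x y => glue y x)) x y].

Definition ring_vertex : finType :=
  {B : {set link_vertex} | B \in codom glue_class}.

Definition to_ring (i : 'I_m) (x : L i) : ring_vertex :=
  Sub (glue_class (in_link x)) (codom_f glue_class (in_link x)).

(* For m >= 2 no two vertices of the same link are identified, so that the
   condition u != v removes nothing. *)
Definition ring_adj : rel ring_vertex := fun u v =>
  (u != v) &&
  [exists i : 'I_m, exists x : L i, exists y : L i,
     [&& adj x y, to_ring x == u & to_ring y == v]].

Fact ring_adj_sym : symmetric ring_adj.
Proof.
suff sub u v : ring_adj u v -> ring_adj v u by move=> u v; apply/idP/idP; exact: sub.
case/andP=> neq_uv /existsP[i /existsP[x /existsP[y /and3P[xy xu yv]]]].
rewrite /ring_adj eq_sym neq_uv; apply/existsP; exists i.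
by apply/existsP; exists y; apply/existsP; exists x; rewrite adj_sym xy yv xu.
Qed.

Fact ring_adj_irrefl : irreflexive ring_adj.
Proof. by move=> u; rewrite /ring_adj eqxx. Qed.

Definition ring_graph : sgraph := SGraph ring_adj_sym ring_adj_irrefl.

End Ring.

(* Main.v *)
(* The five points of a link carry, up to scaling, a unique stress mu_u mu_v, where mu
   is their affine dependency. Modulo the edges of a butterfly it identifies its two
   hinges up to a factor -t_i / s_i, so going once around the ring multiplies a hinge by
   the product of these factors; genericity makes it different from 1, and hence every
   hinge lies in the span of the edges. Conversely, the links of a stressed ring all
   transmit one and the same wrench through the hinges, which has no moment about any
   hinge line. Six generic lines have independent Pluecker vectors, so for m >= 6 this
   wrench vanishes, each link is stressed as a K5 with missing hinge stresses
   compensated by its neighbours, and the product of factors forces the stress to be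
   zero. The case m <= 5 is a comparison of 8m with 9m - 6, and a set W of at least five
   vertices spans at most 3|W| - 7 edges when m >= 7. *)

From HB Require Import structures.
Require Import Defs.
From mathcomp Require Import all_boot all_order all_algebra.
From mathcomp Require Import reals.
From mathcomp.multinomials Require Import (canonicals) mpoly.
From mathcomp Require Import zify ring lra.

Set Implicit Arguments.
Unset Strict Implicit.
Unset Printing Implicit Defensive.

Import Order.TTheory GRing.Theory Num.Theory.
Local Open Scope ring_scope.

(** * Vectors in three-space and generic placements *)

Lemma ord3E (k : 'I_3) : [\/ k = 0, k = 1 | k = 2%:R].
Proof.
by case: k => -[|[|[|//]]] ?; [apply: Or31|apply: Or32|apply: Or33]; apply/val_inj.
Qed.

Lemma rV3P (R : nzRingType) (u v : 'rV[R]_3) :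
  u = v <-> [/\ u 0 0 = v 0 0, u 0 1 = v 0 1 & u 0 2%:R = v 0 2%:R].
Proof.
split=> [->//|[e0 e1 e2]]; apply/rowP => k.
by case: (ord3E k) => ->.
Qed.

Lemma sum3 (R : nmodType) (f : 'I_3 -> R) : \sum_i f i = f 0 + f 1 + f 2%:R.
Proof.
rewrite !big_ord_recl big_ord0 addr0 addrA.
by congr (_ + f _ + f _); apply/val_inj.
Qed.

Definition det3 (R : nzRingType) (u v w : 'rV[R]_3) : R :=
  u 0 0 * (v 0 1 * w 0 2%:R - v 0 2%:R * w 0 1)
  - u 0 1 * (v 0 0 * w 0 2%:R - v 0 2%:R * w 0 0)
  + u 0 2%:R * (v 0 0 * w 0 1 - v 0 1 * w 0 0).

Lemma det3_map (R S : nzRingType) (f : {rmorphism R -> S}) (u v w : 'rV[R]_3) :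
  f (det3 u v w) = det3 (map_mx f u) (map_mx f v) (map_mx f w).
Proof. by rewrite /det3 !mxE !(rmorphD, rmorphN, rmorphM). Qed.

Lemma det3_free (F : fieldType) (u v w : 'rV[F]_3) (x y z : F) :
  det3 u v w != 0 -> x *: u + y *: v + z *: w = 0 -> [/\ x = 0, y = 0 & z = 0].
Proof.
move=> nz /rV3P[]; rewrite !mxE => e0 e1 e2.
(* Cramer's rule *)
have xE : det3 u v w * x = 0.
  rewrite [LHS](_ : _ = (v 0 1 * w 0 2%:R - v 0 2%:R * w 0 1) * (x * u 0 0 + y * v 0 0 + z * w
    0 0)
    - (v 0 0 * w 0 2%:R - v 0 2%:R * w 0 0) * (x * u 0 1 + y * v 0 1 + z * w 0 1)
    + (v 0 0 * w 0 1 - v 0 1 * w 0 0) * (x * u 0 2%:R + y * v 0 2%:R + z * w 0 2%:R));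
      last by rewrite /det3; ring.
  by rewrite e0 e1 e2; ring.
have yE : det3 u v w * y = 0.
  rewrite [LHS](_ : _ = - (u 0 1 * w 0 2%:R - u 0 2%:R * w 0 1) * (x * u 0 0 + y * v 0 0 + z *
    w 0 0)
    + (u 0 0 * w 0 2%:R - u 0 2%:R * w 0 0) * (x * u 0 1 + y * v 0 1 + z * w 0 1)
    - (u 0 0 * w 0 1 - u 0 1 * w 0 0) * (x * u 0 2%:R + y * v 0 2%:R + z * w 0 2%:R));
      last by rewrite /det3; ring.
  by rewrite e0 e1 e2; ring.
have zE : det3 u v w * z = 0.
  rewrite [LHS](_ : _ = (u 0 1 * v 0 2%:R - u 0 2%:R * v 0 1) * (x * u 0 0 + y * v 0 0 + z * w
    0 0)
    - (u 0 0 * v 0 2%:R - u 0 2%:R * v 0 0) * (x * u 0 1 + y * v 0 1 + z * w 0 1)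
    + (u 0 0 * v 0 1 - u 0 1 * v 0 0) * (x * u 0 2%:R + y * v 0 2%:R + z * w 0 2%:R));
      last by rewrite /det3; ring.
  by rewrite e0 e1 e2; ring.
by split; apply/eqP; rewrite -(mulrI_eq0 _ (mulfI nz)) ?xE ?yE ?zE.
Qed.

Definition cross (R : nzRingType) (u v : 'rV[R]_3) : 'rV[R]_3 :=
  \row_k nth 0 [:: u 0 1 * v 0 2%:R - u 0 2%:R * v 0 1;
                   u 0 2%:R * v 0 0 - u 0 0 * v 0 2%:R;
                   u 0 0 * v 0 1 - u 0 1 * v 0 0] k.

Lemma cross_map (R S : nzRingType) (f : {rmorphism R -> S}) (u v : 'rV[R]_3) :
  map_mx f (cross u v) = cross (map_mx f u) (map_mx f v).
Proof. by apply/rV3P; split; rewrite !mxE /= !(rmorphB, rmorphM). Qed.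

(** The determinant makes [u] and [v] independent, and [r] is parallel to both. *)
Lemma cross_eq0 (F : fieldType) (r u v w : 'rV[F]_3) :
  det3 u v w != 0 -> cross r u = 0 -> cross r v = 0 -> r = 0.
Proof.
move=> nz /rV3P[]; rewrite !mxE /= => x1 y1 z1 /rV3P[]; rewrite !mxE /= => x2 y2 z2.
(* each [det3 u v w * r 0 i] is a combination of the entries of [cross r u], [cross r v] *)
have r0 : det3 u v w * r 0 0 = 0.
  rewrite [LHS](_ : _ = w 0 0 * (- v 0 0 * (r 0 1 * u 0 2%:R - r 0 2%:R * u 0 1) - u 0 1 * (r 0
    2%:R * v 0 0 - r 0 0 * v 0 2%:R) - u 0 2%:R * (r 0 0 * v 0 1 - r 0 1 * v 0 0))
    + w 0 1 * (u 0 0 * (r 0 2%:R * v 0 0 - r 0 0 * v 0 2%:R) - v 0 0 * (r 0 2%:R * u 0 0 - r 0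
      0 * u 0 2%:R))
    + w 0 2%:R * (u 0 0 * (r 0 0 * v 0 1 - r 0 1 * v 0 0) - v 0 0 * (r 0 0 * u 0 1 - r 0 1 * u
      0 0))); last by rewrite /det3; ring.
  by rewrite ?(x1, y1, z1, x2, y2, z2); ring.
have r1 : det3 u v w * r 0 1 = 0.
  rewrite [LHS](_ : _ = w 0 1 * (- v 0 1 * (r 0 2%:R * u 0 0 - r 0 0 * u 0 2%:R) - u 0 2%:R *
    (r 0 0 * v 0 1 - r 0 1 * v 0 0) - u 0 0 * (r 0 1 * v 0 2%:R - r 0 2%:R * v 0 1))
    + w 0 2%:R * (u 0 1 * (r 0 0 * v 0 1 - r 0 1 * v 0 0) - v 0 1 * (r 0 0 * u 0 1 - r 0 1 * u
      0 0))
    + w 0 0 * (u 0 1 * (r 0 1 * v 0 2%:R - r 0 2%:R * v 0 1) - v 0 1 * (r 0 1 * u 0 2%:R - r 0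
      2%:R * u 0 1))); last by rewrite /det3; ring.
  by rewrite ?(x1, y1, z1, x2, y2, z2); ring.
have r2 : det3 u v w * r 0 2%:R = 0.
  rewrite [LHS](_ : _ = w 0 2%:R * (- v 0 2%:R * (r 0 0 * u 0 1 - r 0 1 * u 0 0) - u 0 0 * (r 0
    1 * v 0 2%:R - r 0 2%:R * v 0 1) - u 0 1 * (r 0 2%:R * v 0 0 - r 0 0 * v 0 2%:R))
    + w 0 0 * (u 0 2%:R * (r 0 1 * v 0 2%:R - r 0 2%:R * v 0 1) - v 0 2%:R * (r 0 1 * u 0 2%:R
      - r 0 2%:R * u 0 1))
    + w 0 1 * (u 0 2%:R * (r 0 2%:R * v 0 0 - r 0 0 * v 0 2%:R) - v 0 2%:R * (r 0 2%:R * u 0 0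
      - r 0 0 * u 0 2%:R))); last by rewrite /det3; ring.
  by rewrite ?(x1, y1, z1, x2, y2, z2); ring.
by apply/rV3P; split; rewrite mxE; apply: (mulfI nz); rewrite mulr0.
Qed.

(* The wrench of forces [u] at [a] and [v] at [b] has no moment about the line [ab]. *)
Lemma moment_hinge (R : comNzRingType) (a b u v : 'rV[R]_3) :
  \sum_k (u + v) 0 k * cross a b 0 k
  + \sum_k (cross a u + cross b v) 0 k * (b - a) 0 k = 0.
Proof. by rewrite !sum3 !mxE /=; ring. Qed.

Lemma crossvN (R : nzRingType) (u v : 'rV[R]_3) : cross u (- v) = - cross u v.
Proof. by apply/rV3P; split; rewrite !mxE /= !mulrN opprB opprK addrC. Qed.

Lemma crossv0 (R : nzRingType) (u : 'rV[R]_3) : cross u 0 = 0.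
Proof. by apply/rV3P; split; rewrite !mxE /= !mulr0 subrr. Qed.

(** Each edge contributes opposite forces along its own line, so forces and moments cancel. The
    pairs [ab] and [cd] are absent, as in a butterfly. *)
Lemma link_balance (R : comNzRingType) (a b c d e : 'rV[R]_3) (ac ad ae bc bd be ce de : R) :
  let fa := ac *: (a - c) + ad *: (a - d) + ae *: (a - e) in
  let fb := bc *: (b - c) + bd *: (b - d) + be *: (b - e) in
  let fc := ac *: (c - a) + bc *: (c - b) + ce *: (c - e) in
  let fd := ad *: (d - a) + bd *: (d - b) + de *: (d - e) in
  let fe := ae *: (e - a) + be *: (e - b) + ce *: (e - c) + de *: (e - d) in
  fa + fb + fc + fd + fe = 0 /\
  cross a fa + cross b fb + cross c fc + cross d fd + cross e fe = 0.
Proof. by split; apply/rV3P; split; rewrite !mxE /= ?mxE; ring. Qed.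

(** An expression natural in the ring is a rational polynomial: its value at the indeterminates [X]
    specializes to every placement. A rational placement where it does not vanish shows this
    polynomial to be nonzero. *)
Lemma generic_neq0 (R : realType) (V : finType) (p : V -> 'rV[R]_3)
    (f : forall A : comNzRingType, (V -> 'rV[A]_3) -> A) :
  (forall (A B : comNzRingType) (h : {rmorphism A -> B}) (q : V -> 'rV[A]_3)
     (q' : V -> 'rV[B]_3), (forall v, q' v = map_mx h (q v)) -> h (f A q) = f B q') ->
  generic p -> (exists q : V -> 'rV[rat]_3, f rat q != 0) -> f R p != 0.
Proof.
move=> f_nat p_gen [q fq].
pose A := [the comNzRingType of mpoly.mpoly #|{: V * 'I_3}| rat].
pose X v : 'rV[A]_3 := \row_k mpoly.mpolyX rat (mpoly.mnm1 (enum_rank (v, k))).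
have fX (S : comNzRingType) (h : {rmorphism rat -> S}) (r : V -> 'rV[S]_3) :
    mpoly.mmap h (fun k => r (enum_val k).1 0 (enum_val k).2) (f A X) = f S r.
  pose H := [the {rmorphism A -> S} of
    mpoly.mmap h (fun k => r (enum_val k).1 0 (enum_val k).2)].
  apply: (f_nat A S H) => v; apply/rowP => k.
  by rewrite !mxE /= mpoly.mmapX mpoly.mmap1U enum_rankK.
rewrite -(fX R ratr p); apply: p_gen.
apply: contraNneq fq => fX0; rewrite -(fX rat idfun) fX0.
by rewrite mpoly.mmap0.
Qed.

(** * Rank in the rigidity matroid *)

Section RigidityRank.
Variables (R : realType) (V : finType) (p : V -> 'rV[R]_3).
Implicit Types (F D : {set {set V}}) (w : {set V} -> R).

Definition force (e : {set V}) (v : V) : 'rV[R]_3 :=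
  if v \in e then \sum_(u in e) (p v - p u) else 0.

(** An element of the left kernel of the rigidity matrix, read vertex by vertex. *)
Definition stress F w := forall v, \sum_(e in F) w e *: force e v = 0.

Lemma force_pair (x y v : V) : x != y ->
  force [set x; y] v = (v == x)%:R *: (p x - p y) + (v == y)%:R *: (p y - p x).
Proof.
move=> xy; rewrite /force !inE; have [->|vx] /= := eqVneq v x.
  by rewrite (negbTE xy) big_setU1 ?inE //= big_set1 subrr add0r scale1r scale0r addr0.
have [->|vy] /= := eqVneq v y; last by rewrite !scale0r addr0.
by rewrite big_setU1 ?inE //= big_set1 subrr addr0 scale1r scale0r add0r.
Qed.

Lemma stressE F w :
  stress F w <-> (\row_k w (enum_val k)) *m rigidity_matrix p F = 0.
Proof.
have mulE : (\row_k w (enum_val k)) *m rigidity_matrix p F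
    = mxvec (\sum_(e in F) w e *: rigidity_row p e).
  rewrite mulmx_sum_row (big_enum_val (fun e => w e *: rigidity_row p e)) linear_sum /=.
  by apply: eq_bigr => k _; rewrite mxE rowK linearZ.
have rowE v : row (enum_rank v) (\sum_(e in F) w e *: rigidity_row p e)
    = \sum_(e in F) w e *: force e v.
  rewrite linear_sum /=; apply: eq_bigr => e _.
  by rewrite linearZ /= rowK enum_rankK.
rewrite mulE; split=> [F0|/(canRL mxvecK)]; last first.
  by rewrite linear0 => F0 v; rewrite -rowE F0 linear0.
apply/eqP; rewrite mxvec_eq0; apply/eqP/row_matrixP => k.
by rewrite -(enum_valK k) rowE F0 row0.
Qed.

Lemma row_enum F (u : 'rV[R]_#|F|) : exists w, u = \row_k w (enum_val k).
Proof.
exists (fun e => if [pick k | enum_val k == e] is Some k then u 0 k else 0).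
apply/rowP => k; rewrite mxE; case: pickP => [j /eqP/enum_val_inj->//|/(_ k)].
by rewrite eqxx.
Qed.

Lemma independentP F :
  independent3 p F <-> (forall w, stress F w -> {in F, forall e, w e = 0}).
Proof.
have rowfree : independent3 p F <-> row_free (rigidity_matrix p F).
  by rewrite /independent3 /rank3; split=> [/eqP|/eqP].
rewrite rowfree; split=> [Ffree w /stressE wF e eF | Find].
  have /rowP/(_ (enum_rank_in eF e)) := row_free_inj Ffree (etrans wF (esym (mul0mx _ _))).
  by rewrite !mxE enum_rankK_in.
apply: inj_row_free => u; have [w ->] := row_enum u => /stressE wF.
by apply/rowP => k; rewrite !mxE; apply: Find (enum_valP k).
Qed.

Lemma stress_subset F D w : D \subset F -> stress D w ->
  stress F (fun e => if e \in D then w e else 0).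
Proof.
move=> DF wD v; rewrite -[RHS](wD v) [LHS](bigID (mem D)) /= [X in _ + X]big1 ?addr0.
  apply: eq_big => [e|e /andP[_ ->//]].
  by apply/andP/idP => [[]//|eD]; rewrite (subsetP DF).
by move=> e /andP[_ /negbTE->]; rewrite scale0r.
Qed.

Lemma independentS F D : D \subset F -> independent3 p F -> independent3 p D.
Proof.
move=> DF /independentP Find; apply/independentP => w /(stress_subset DF) wD e eD.
by have := Find _ wD e (subsetP DF e eD); rewrite eD.
Qed.

Lemma rank3S F D : D \subset F -> (rank3 p D <= rank3 p F)%N.
Proof.
move=> DF; apply/mxrankS/row_subP => k; rewrite rowK.
have kF := subsetP DF _ (enum_valP k).
have -> : enum_val k = enum_val (enum_rank_in kF (enum_val k)) by rewrite enum_rankK_in.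
by rewrite -(rowK (fun k => mxvec (rigidity_row p (enum_val k)))) row_sub.
Qed.

(* A circuit through f is the support of a stress nonzero on f whose support is
   minimal: any dependency inside it avoids f, and subtracting a multiple of it
   would shrink the support. *)
Lemma circuit_through F w (f : {set V}) : f \in F -> stress F w -> w f != 0 ->
  exists C : {set {set V}}, [/\ C \subset F, f \in C & circuit3 p C].
Proof.
have [n] := ubnP #|F|; elim: n F w => // n IHn F w /ltnSE leFn fF wF wf.
have shrink D w' : D \proper F -> f \in D -> stress D w' -> w' f != 0 ->
    exists C : {set {set V}}, [/\ C \subset F, f \in C & circuit3 p C].
  move=> DF fD w'D w'f; have ltDn := leq_trans (proper_card DF) leFn.
  have [C [CD fC circC]] := IHn D w' ltDn fD w'D w'f.
  by exists C; split=> //; apply: subset_trans CD (proper_sub DF).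
have [/existsP[D /andP[DF depD]]|/existsPn Find] :=
    boolP [exists D : {set {set V}}, (D \proper F) && (rank3 p D != #|D|)]; last first.
  exists F; split=> //; split=> [/independentP/(_ w wF f fF) wf0|D DF].
    by rewrite wf0 eqxx in wf.
  by have := Find D; rewrite DF /= negbK => /eqP.
have [w' [w'D [g gD w'g]]] : exists w', stress D w' /\ exists2 g, g \in D & w' g != 0.
  pose u := nz_row (kermx (rigidity_matrix p D)).
  have nzu : u != 0.
    rewrite nz_row_eq0 kermx_eq0; apply: contra depD; exact.
  have uD : u *m rigidity_matrix p D = 0 by apply/sub_kermxP; apply: nz_row_sub.
  have [w' uE] := row_enum u; exists w'; split; first by apply/stressE; rewrite -uE.
  have [k] := rV0Pn _ nzu; rewrite uE mxE => w'k.
  by exists (enum_val k); first exact: enum_valP.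
have [w'f|] := boolP ((f \in D) && (w' f != 0)); first by case/andP: w'f => fD w'f; apply:
  shrink DF fD w'D w'f.
rewrite negb_and negbK => w'f0.
have gF := subsetP (proper_sub DF) g gD.
have gf : f != g.
  by apply: contraL w'f0 => /eqP->; rewrite gD.
pose w0 e := if e \in D then w' e else 0.
have w0F : stress F w0 by apply: stress_subset w'D; apply: proper_sub.
(* The multiple is chosen to cancel [g]; the value at [f] is kept, since [w0] vanishes there. *)
pose w1 e := w e - w g / w0 g * w0 e.
apply: (shrink (F :\ g) w1); rewrite ?properD1 ?inE ?gf //; last first.
  rewrite /w1 (_ : w0 f = 0) ?mulr0 ?subr0 //.
  by rewrite /w0; case: ifP => // fD; move: w'f0; rewrite fD => /eqP.
have w1g : w1 g = 0 by rewrite /w1 divfK ?subrr // /w0 gD.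
have w1F : stress F w1.
  move=> v; rewrite [LHS](_ : _ = \sum_(e in F) w e *: force e v -
    (w g / w0 g) *: \sum_(e in F) w0 e *: force e v).
    by rewrite wF w0F scaler0 subrr.
  rewrite scaler_sumr -sumrB; apply: eq_bigr => e _.
  by rewrite /w1 scalerBl scalerA.
by move=> v; rewrite -[RHS](w1F v) [RHS](big_setD1 g) //= w1g scale0r add0r.
Qed.

End RigidityRank.

(** No four points are coplanar. *)
Definition general_position (R : nzRingType) (V : finType) (p : V -> 'rV[R]_3) :=
  forall x y z t : V, uniq [:: x; y; z; t] ->
    det3 (p x - p y) (p x - p z) (p x - p t) != 0.

Lemma generic_general_position (R : realType) (V : finType) (p : V -> 'rV[R]_3) :
  generic p -> general_position p.
Proof.
move=> p_gen x y z t; rewrite /= !inE !negb_or.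
case/and4P=> [/and3P[xy xz xt] /andP[yz yt] zt _].
apply: (@generic_neq0 _ _ _
  (fun A q => det3 (q x - q y) (q x - q z) (q x - q t))) p_gen _.
  by move=> A B h q q' q'E; rewrite det3_map !q'E !map_mxB.
(* [x] goes to the origin and [y], [z], [t] to the three unit vectors. *)
pose q v : 'rV[rat]_3 := \row_k ((v == y) && (k == 0) || (v == z) && (k == 1)
  || (v == t) && (k == 2%:R))%:R.
exists q; rewrite /det3 /q !mxE !eqxx /=.
rewrite (negbTE xy) (negbTE xz) (negbTE xt) (negbTE yz) (negbTE yt) (negbTE zt).
by rewrite [z == y]eq_sym [t == y]eq_sym [t == z]eq_sym (negbTE yz) (negbTE yt) (negbTE zt).
Qed.

(** * Rank bounds for points in general position *)

Section GeneralPosition.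
Variables (R : realType) (V : finType) (p : V -> 'rV[R]_3).
Hypothesis p_gp : general_position p.
Implicit Types (F : {set {set V}}) (W : {set V}).

(** Attaching a vertex by three edges: they leave [x] in independent directions, so balance at [x]
    makes their weights vanish and leaves a stress of [F]. *)
Lemma independent_ext F (x y z t : V) : uniq [:: x; y; z; t] ->
    {in F, forall e : {set V}, x \notin e} -> independent3 p F ->
  independent3 p ([set x; y] |: ([set x; z] |: ([set x; t] |: F))).
Proof.
move=> uniq_xyzt xF /independentP Find; have gp := p_gp uniq_xyzt.
move: uniq_xyzt; rewrite /= !inE !negb_or.
case/and4P=> [/and3P[xy xz xt] /andP[yz yt] zt _].
have xE u : [set x; u] \notin F.
  by apply/negP => /xF; rewrite !inE eqxx.
have pairE u v : x != u -> u != v -> [set x; u] != [set x; v].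
  move=> xu uv; apply/eqP => /setP/(_ u).
  by rewrite !inE eqxx orbT (negbTE uv) eq_sym (negbTE xu).
apply/independentP => w wF.
have sumE v : w [set x; y] *: force p [set x; y] v
    + (w [set x; z] *: force p [set x; z] v
    + (w [set x; t] *: force p [set x; t] v
    + \sum_(e in F) w e *: force p e v)) = 0.
  by have := wF v; rewrite !big_setU1 ?inE ?negb_or ?xE ?pairE.
have xF0 : \sum_(e in F) w e *: force p e x = 0.
  by rewrite big1 // => e /xF xe; rewrite /force (negbTE xe) scaler0.
have := sumE x; rewrite xF0 addr0 !force_pair // eqxx.
rewrite (negbTE xy) (negbTE xz) (negbTE xt) !scale0r !addr0 !scale1r addrA.
case/(det3_free gp) => wy wz wt.
have wF' : stress p F w.
  by move=> v; rewrite -[RHS](sumE v) wy wz wt !scale0r !add0r.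
by move=> e; rewrite !inE => /or4P[/eqP->|/eqP->|/eqP->|eF] //; exact: Find wF' e eF.
Qed.

(** A triangle is independent, and each further vertex is attached to three others by three
    edges. *)
Lemma rank_complete_edges W : (4 <= #|V|)%N -> (3 <= #|W|)%N ->
  (3 * #|W| <= rank3 p (complete_edges W) + 6)%N.
Proof.
move=> V4; suff : (3 <= #|W|)%N -> exists F : {set {set V}},
    [/\ F \subset complete_edges W, independent3 p F & (3 * #|W| <= #|F| + 6)%N].
  move=> + W3 => /(_ W3)[F [FW Find cardF]].
  by rewrite (leq_trans cardF) // leq_add2r -{1}Find rank3S.
have pair_complete (W0 : {set V}) x y : x \in W0 -> y \in W0 -> x != y ->
    [set x; y] \in complete_edges W0.
  by move=> xW yW xy; rewrite inE cards2 xy subUset !sub1set xW yW.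
have pair_neq (x u v : V) : x != u -> u != v -> [set x; u] != [set x; v].
  move=> xu uv; apply/eqP => /setP/(_ u).
  by rewrite !inE eqxx orbT (negbTE uv) eq_sym (negbTE xu).
have [n] := ubnP #|W|; elim: n W => // n IHn W /ltnSE leWn W3.
have [/existsP[x /andP[xW W'3]]|/existsPn noW'] :=
    boolP [exists x, (x \in W) && (3 <= #|W :\ x|)%N].
  have cardW : #|W| = #|W :\ x|.+1 by rewrite (cardsD1 x W) xW.
  have [|//|F [FW' Find cardF]] := IHn (W :\ x); rewrite -?cardW //.
  have /card_gt2P[y [z [t [[yW' zW' tW'] [yz zt ty]]]]] := W'3.
  rewrite eq_sym in ty.
  have W'W v : v \in W :\ x -> (v \in W) && (x != v).
    by rewrite in_setD1 eq_sym andbC.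
  have /andP[yW xy] := W'W _ yW'; have /andP[zW xz] := W'W _ zW'.
  have /andP[tW xt] := W'W _ tW'.
  have xF : {in F, forall e : {set V}, x \notin e}.
    move=> e /(subsetP FW'); rewrite inE subsetD1.
    by case/andP=> /andP[].
  have xNF u : [set x; u] \notin F by apply/negP => /xF; rewrite !inE eqxx.
  exists ([set x; y] |: ([set x; z] |: ([set x; t] |: F))); split.
  - rewrite !subUset !sub1set !pair_complete //=.
    apply/subsetP => e /(subsetP FW'); rewrite !inE subsetD1.
    by case/andP=> /andP[-> _].
  - by apply: independent_ext => //=; rewrite !inE !negb_or xy xz xt yz ty zt.
  - rewrite !cardsU1 !inE !negb_or !xNF !pair_neq //= cardW mulnS.
    exact: leq_add (leqnn 3) cardF.
have /card_gt2P[x [y [z [[xW yW zW] [xy yz zx]]]]] := W3.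
rewrite eq_sym in zx.
have cardW : #|W| = 3.
  apply/eqP; rewrite eqn_leq W3 andbT; have := noW' x.
  by rewrite xW -ltnNge (cardsD1 x W) xW.
(* A fourth point [u] supplies the quadruples that [independent_ext] requires; the edges to [u] are
   discarded afterwards by [independentS]. *)
have /card_gt0P[u] : (0 < #|~: W|)%N by rewrite cardsCs setCK subn_gt0 cardW.
rewrite inE => uW.
have neq_u v : v \in W -> v != u by apply: contraTneq => ->.
have x_yz : x \notin [set y; z] by rewrite !inE negb_or xy zx.
have xN v : [set x; v] != [set y; z].
  by apply: contraNneq x_yz => <-; rewrite !inE eqxx.
exists ([set x; y] |: ([set x; z] |: [set [set y; z]])); split.
- by rewrite !subUset !sub1set !pair_complete.
- have uniq_y : uniq [:: y; z; x; u].
    by rewrite /= !inE !negb_or yz eq_sym xy !neq_u // eq_sym zx.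
  have uniq_x : uniq [:: x; y; z; u].
    by rewrite /= !inE !negb_or yz xy zx !neq_u.
  have ind1 : independent3 p [set [set y; z]].
    apply: independentS (independent_ext (F := set0) uniq_y _ _).
    + by rewrite sub1set !inE eqxx.
    + by move=> e; rewrite inE.
    + by apply/independentP => w _ e; rewrite inE.
  apply: independentS (independent_ext (F := [set [set y; z]]) uniq_x _ ind1).
    by apply/subsetP => e; rewrite !inE => /or3P[] ->; rewrite ?orbT.
  by move=> e; rewrite inE => /eqP->.
- by rewrite !cardsU1 cards1 !inE !negb_or !xN !pair_neq //= cardW.
Qed.

Lemma mxvec_dot m n (A B : 'M[R]_(m, n)) :
  \sum_k mxvec A 0 k * mxvec B 0 k = \sum_i \sum_j A i j * B i j.
Proof.
rewrite pair_bigA (reindex _ (curry_mxvec_bij _ _)) /=.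
by apply: eq_bigr => -[i j] _ /=; rewrite !mxvecE.
Qed.

(** The velocity at [x] of an infinitesimal rigid motion: the left half of [u] is the translation,
    the right half the rotation vector. *)
Definition twist (u : 'rV[R]_(3 + 3)) (x : 'rV[R]_3) : 'rV[R]_3 :=
  lsubmx u + cross (rsubmx u) x.

Definition velocities (u : 'rV[R]_(3 + 3)) : 'rV[R]_(#|V| * 3) :=
  mxvec (\matrix_(k < #|V|) twist u (p (enum_val k))).

Fact velocities_linear : linear velocities.
Proof.
move=> c u v; rewrite /velocities -linearP; congr mxvec; apply/row_matrixP => k.
rewrite linearP /= !rowK; apply/rV3P; split; rewrite !mxE /= ?mxE; ring.
Qed.

HB.instance Definition _ := GRing.isLinear.Build R _ _ _ velocities velocities_linear.

(** The rigid motions form a six-dimensional space annihilated by every row of the rigidity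
    matrix. *)
Lemma rank_le F : (4 <= #|V|)%N -> {in F, forall e : {set V}, #|e| = 2} ->
  (rank3 p F + 6 <= 3 * #|V|)%N.
Proof.
move=> V4 F2.
(* A motion at rest at all points has a rotation vector parallel to two independent differences, so
   rotation and translation both vanish. *)
have /eqP rank_vel : row_free (lin1_mx velocities).
  apply: inj_row_free => u; rewrite mul_rV_lin1 /= => /(canRL mxvecK).
  rewrite linear0 => u0.
  have tw v : twist u (p v) = 0.
    by have := congr1 (row (enum_rank v)) u0; rewrite rowK enum_rankK row0.
  have [x [y [z [t uniq_xyzt]]]] : exists x y z t : V, uniq [:: x; y; z; t].
    have : uniq (take 4 (enum V)) by rewrite take_uniq ?enum_uniq.
    have : size (take 4 (enum V)) = 4 by rewrite size_takel // -cardE.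
    by case: (take 4 _) => [|x [|y [|z [|t [|//]]]]] // _; exists x, y, z, t.
  have cr v : cross (rsubmx u) (p x - p v) = 0.
    have -> : cross (rsubmx u) (p x - p v) = twist u (p x) - twist u (p v).
      by rewrite /twist; apply/rV3P; split; rewrite !mxE /= ?mxE; ring.
    by rewrite !tw subrr.
  have r0 := cross_eq0 (p_gp uniq_xyzt) (cr _) (cr _).
  have l0 : lsubmx u = 0.
    rewrite -(tw x) /twist r0; apply/rV3P; split; rewrite !mxE /= ?mxE; ring.
  by rewrite -(hsubmxK u) l0 r0 row_mx0.
suff: (rank3 p F + \rank (lin1_mx velocities) <= 3 * #|V|)%N by rewrite rank_vel.
rewrite -[X in (_ + X)%N]mxrank_tr [X in (_ <= X)%N]mulnC; apply: mulmx0_rank_max.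
apply/row_matrixP => k; rewrite row_mul row0 rowK; set e := enum_val k.
have /cards2P[x [y [xy eE]]] : #|e| == 2 by rewrite F2 ?enum_valP.
apply/rowP => j; rewrite !mxE; pose T v := twist (delta_mx 0 j) (p v).
(* Only the two ends of the edge contribute, and they cancel because the velocity difference is
   orthogonal to the edge. *)
transitivity (\sum_v \sum_b force p e v 0 b * T v 0 b).
  under eq_bigr => k' _ do rewrite 2!mxE.
  rewrite mxvec_dot (reindex enum_rank) /=; last by apply/onW_bij/enum_rank_bij.
  apply: eq_bigr => v _; apply: eq_bigr => b _; rewrite !mxE enum_rankK.
  by congr (_ * _); rewrite /force; case: ifP => _; rewrite ?mxE.
rewrite (bigD1 x) //= (bigD1 y) 1?eq_sym //= [X in _ + (_ + X)]big1 ?addr0 => [|v /andP[vx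
  vy]]; last first.
  by rewrite big1 // => b _; rewrite eE force_pair // (negbTE vx) (negbTE vy) !scale0r addr0
    mxE mul0r.
rewrite eE !force_pair // !eqxx [y == x]eq_sym (negbTE xy) !scale0r !scale1r add0r addr0.
by rewrite !sum3 /T /twist !mxE /= ?mxE; ring.
Qed.

End GeneralPosition.

(** * Stresses of a link *)

Section CompleteGraph5.
Variable R : comNzRingType.
Implicit Types a b c d e : 'rV[R]_3.

(* [mu1, ..., mu5] are the coefficients of the affine dependency of five points,
   given by Cramer's rule; the products [mui * muj] form a stress of K5. *)
Definition mu1 a b c d e : R := det3 (b - e) (c - e) (d - e).
Definition mu2 a b c d e : R := - det3 (a - e) (c - e) (d - e).
Definition mu3 a b c d e : R := det3 (a - e) (b - e) (d - e).
Definition mu4 a b c d e : R := - det3 (a - e) (b - e) (c - e).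
Definition mu5 a b c d e : R :=
  - (mu1 a b c d e + mu2 a b c d e + mu3 a b c d e + mu4 a b c d e).

Lemma mu_relation a b c d e :
  mu1 a b c d e *: (a - e) + mu2 a b c d e *: (b - e) + mu3 a b c d e *: (c - e)
  + mu4 a b c d e *: (d - e) = 0.
Proof.
by rewrite /mu1 /mu2 /mu3 /mu4 /det3; apply/rV3P; split; rewrite !mxE; ring.
Qed.

(** In determinant form the fifth coefficient is also nonzero in general position. *)
Lemma mu5E a b c d e : mu5 a b c d e = det3 (a - b) (a - c) (a - d).
Proof. by rewrite /mu5 /mu1 /mu2 /mu3 /mu4 /det3 !mxE; ring. Qed.

(** The coefficients sum to zero, so the base point [e] may be replaced by any [x]. At a vertex,
    scaled by its own coefficient, this is the balance of the stress of K5. *)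
Lemma K5_relation a b c d e (x : 'rV[R]_3) :
  mu1 a b c d e *: (x - a) + mu2 a b c d e *: (x - b) + mu3 a b c d e *: (x - c)
  + mu4 a b c d e *: (x - d) + mu5 a b c d e *: (x - e) = 0.
Proof.
rewrite -[RHS]oppr0 -(mu_relation a b c d e) /mu5.
move: (mu1 a b c d e) (mu2 a b c d e) (mu3 a b c d e) (mu4 a b c d e) => m1 m2 m3 m4.
by apply/rV3P; split; rewrite !mxE; ring.
Qed.

End CompleteGraph5.

Lemma mu_map (R S : comNzRingType) (f : {rmorphism R -> S}) (a b c d e : 'rV[R]_3) :
  let g := map_mx f in
  [/\ f (mu1 a b c d e) = mu1 (g a) (g b) (g c) (g d) (g e),
      f (mu2 a b c d e) = mu2 (g a) (g b) (g c) (g d) (g e),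
      f (mu3 a b c d e) = mu3 (g a) (g b) (g c) (g d) (g e)
    & f (mu4 a b c d e) = mu4 (g a) (g b) (g c) (g d) (g e)].
Proof. by split; rewrite ?rmorphN; rewrite det3_map !map_mxB. Qed.

Lemma cross_eq0_parallel (F : fieldType) (u v : 'rV[F]_3) :
  u != 0 -> cross u v = 0 -> exists k, v = k *: u.
Proof.
move=> u0 /rV3P[]; rewrite !mxE /= => /subr0_eq e0 /subr0_eq e1 /subr0_eq e2.
have [i ui] := rV0Pn _ u0; exists (v 0 i / u 0 i).
suff vE j : v 0 j * u 0 i = v 0 i * u 0 j.
  by apply/rowP => j; rewrite mxE mulrAC -vE mulfK.
case: (ord3E i) => ->; case: (ord3E j) => -> //;
  rewrite ![v _ _ * _]mulrC;
  by first [exact: e0 | exact: e1 | exact: e2 | rewrite e0 | rewrite e1 | rewrite e2].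
Qed.

(* [near_coef q i] and [far_coef q i] are the values on the hinges [i] and [ordS i] of the
   stress of the K5 on link [i]; a point of the ring is labelled [(i, Some s)] on hinge [i]
   and [(i, None)] at the apex of link [i]. *)
Definition near_coef (A : comNzRingType) m (q : 'I_m * option bool -> 'rV[A]_3) i :=
  let a := q (i, Some false) in let b := q (i, Some true) in
  let c := q (ordS i, Some false) in let d := q (ordS i, Some true) in
  let e := q (i, None) in mu1 a b c d e * mu2 a b c d e.

Definition far_coef (A : comNzRingType) m (q : 'I_m * option bool -> 'rV[A]_3) i :=
  let a := q (i, Some false) in let b := q (i, Some true) in
  let c := q (ordS i, Some false) in let d := q (ordS i, Some true) in
  let e := q (i, None) in mu3 a b c d e * mu4 a b c d e.

(* Row [k] holds the Pluecker coordinates of the line through hinge [h k]. *)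
Definition hinge_lines (A : comNzRingType) m (q : 'I_m * option bool -> 'rV[A]_3)
    (h : 'I_(3 + 3) -> 'I_m) : 'M[A]_(3 + 3) :=
  \matrix_k row_mx (cross (q (h k, Some false)) (q (h k, Some true)))
                   (q (h k, Some true) - q (h k, Some false)).

Lemma hinge_linesE (A : comNzRingType) m (q : 'I_m * option bool -> 'rV[A]_3) h k l :
  hinge_lines q h k l = row_mx (cross (q (h k, Some false)) (q (h k, Some true)))
    (q (h k, Some true) - q (h k, Some false)) 0 l.
Proof. by rewrite mxE. Qed.

Section K5.
Variables (R : realType) (V : finType) (p : V -> 'rV[R]_3).
Hypothesis p_gp : general_position p.

Lemma star_free (x y z t : V) (xy xz xt : R) : uniq [:: x; y; z; t] ->
  xy *: (p x - p y) + xz *: (p x - p z) + xt *: (p x - p t) = 0 ->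
  [/\ xy = 0, xz = 0 & xt = 0].
Proof. by move/p_gp/det3_free; apply. Qed.

Variables a b c d e : V.
Hypothesis abcde : uniq [:: a; b; c; d; e].

Let sub4 (i j k l : 'I_5) : uniq [:: i; j; k; l] ->
  uniq [seq nth a [:: a; b; c; d; e] (val x) | x <- [:: i; j; k; l]].
Proof.
move=> uniq_ijkl; rewrite map_inj_uniq // => x y /eqP.
by rewrite nth_uniq ?ltn_ord // => /eqP/val_inj.
Qed.

(** Without [ae] only three edges remain at [a], and general position makes them vanish; the same
    argument then applies at [e], [b] and [c] in turn. *)
Lemma K5_stress0 (ab ac ad ae bc bd be cd ce de : R) :
  ab *: (p a - p b) + ac *: (p a - p c) + ad *: (p a - p d) + ae *: (p a - p e) = 0 ->
  ab *: (p b - p a) + bc *: (p b - p c) + bd *: (p b - p d) + be *: (p b - p e) = 0 ->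
  ac *: (p c - p a) + bc *: (p c - p b) + cd *: (p c - p d) + ce *: (p c - p e) = 0 ->
  ae *: (p e - p a) + be *: (p e - p b) + ce *: (p e - p c) + de *: (p e - p d) = 0 ->
  ae = 0 ->
  [/\ ab = 0, ac = 0, ad = 0, bc = 0 & bd = 0] /\ [/\ be = 0, cd = 0, ce = 0 & de = 0].
Proof.
move=> Fa Fb Fc Fe ae0; move: Fa Fb Fc Fe; rewrite ae0 !scale0r add0r addr0.
move=> /star_free[]; first exact: (sub4 (i := 0) (j := 1) (k := 2%:R) (l := 3%:R)).
move=> -> -> ->; rewrite !scale0r !add0r => Fb Fc.
case/star_free; first exact: (sub4 (i := 4%:R) (j := 1) (k := 2%:R) (l := 3%:R)).
move=> be0 ce0 de0; move: Fb Fc; rewrite be0 ce0 de0 !scale0r !addr0.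
(* A zero term restores the three summands expected by [star_free]. *)
rewrite -(addr0 (_ + _)) -{1}(scale0r (p b - p a)).
case/star_free; first exact: (sub4 (i := 1) (j := 2%:R) (k := 3%:R) (l := 0)).
move=> -> -> _; rewrite scale0r add0r.
rewrite -(addr0 (_ *: _)) -{1}(scale0r (p c - p a)) -[X in X = _]addr0 -{1}(scale0r (p c - p b)).
case/star_free; first exact: (sub4 (i := 2%:R) (j := 3%:R) (k := 0) (l := 1)).
by move=> -> _ _.
Qed.

Let m1 := mu1 (p a) (p b) (p c) (p d) (p e).
Let m2 := mu2 (p a) (p b) (p c) (p d) (p e).
Let m3 := mu3 (p a) (p b) (p c) (p d) (p e).
Let m4 := mu4 (p a) (p b) (p c) (p d) (p e).
Let m5 := mu5 (p a) (p b) (p c) (p d) (p e).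

Lemma mu_neq0 : [/\ m1 != 0, m2 != 0, m3 != 0, m4 != 0 & m5 != 0].
Proof.
have vol_neq0 (x y z t : V) : uniq [:: t; x; y; z] -> det3 (p x - p t) (p y - p t) (p z - p t)
  != 0.
  move/p_gp; rewrite -oppr_eq0 /det3 !mxE; congr (_ != 0); ring.
rewrite /m1 /m2 /m3 /m4 /m5 mu5E /mu1 /mu2 /mu3 /mu4 !oppr_eq0; split.
- apply: vol_neq0; exact: (sub4 (i := 4%:R) (j := 1) (k := 2%:R) (l := 3%:R)).
- apply: vol_neq0; exact: (sub4 (i := 4%:R) (j := 0) (k := 2%:R) (l := 3%:R)).
- apply: vol_neq0; exact: (sub4 (i := 4%:R) (j := 0) (k := 1%:R) (l := 3%:R)).
- apply: vol_neq0; exact: (sub4 (i := 4%:R) (j := 0) (k := 1%:R) (l := 2%:R)).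
- apply: p_gp; exact: (sub4 (i := 0) (j := 1) (k := 2%:R) (l := 3%:R)).
Qed.

(** Subtracting the multiple of the known stress that cancels [ae] leaves the situation of
    [K5_stress0]. *)
Lemma K5_stress (ab ac ad ae bc bd be cd ce de : R) :
  ab *: (p a - p b) + ac *: (p a - p c) + ad *: (p a - p d) + ae *: (p a - p e) = 0 ->
  ab *: (p b - p a) + bc *: (p b - p c) + bd *: (p b - p d) + be *: (p b - p e) = 0 ->
  ac *: (p c - p a) + bc *: (p c - p b) + cd *: (p c - p d) + ce *: (p c - p e) = 0 ->
  ae *: (p e - p a) + be *: (p e - p b) + ce *: (p e - p c) + de *: (p e - p d) = 0 ->
  exists k,
  [/\ ab = k * (m1 * m2), ac = k * (m1 * m3), ad = k * (m1 * m4), ae = k * (m1 * m5)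
     & bc = k * (m2 * m3)] /\
  [/\ bd = k * (m2 * m4), be = k * (m2 * m5), cd = k * (m3 * m4), ce = k * (m3 * m5)
     & de = k * (m4 * m5)].
Proof.
move=> Fa Fb Fc Fe; have [m1n0 m2n0 m3n0 m4n0 m5n0] := mu_neq0.
pose k := ae / (m1 * m5); exists k.
have rel x := K5_relation (p a) (p b) (p c) (p d) (p e) x.
have eq0 (x y z : 'rV[R]_3) (u : R) : x = 0 -> y = 0 -> x - u *: y = z -> z = 0.
  by move=> -> ->; rewrite scaler0 subrr.
have := @K5_stress0 (ab - k * (m1 * m2)) (ac - k * (m1 * m3)) (ad - k * (m1 * m4))
   (ae - k * (m1 * m5)) (bc - k * (m2 * m3)) (bd - k * (m2 * m4)) (be - k * (m2 * m5))
   (cd - k * (m3 * m4)) (ce - k * (m3 * m5)) (de - k * (m4 * m5)).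
case.
- apply: (eq0 _ _ _ (k * m1) Fa (rel (p a))); apply/rV3P; split; rewrite !mxE -/m1 -/m2 -/m3
  -/m4 -/m5; ring.
- apply: (eq0 _ _ _ (k * m2) Fb (rel (p b))); apply/rV3P; split; rewrite !mxE -/m1 -/m2 -/m3
  -/m4 -/m5; ring.
- apply: (eq0 _ _ _ (k * m3) Fc (rel (p c))); apply/rV3P; split; rewrite !mxE -/m1 -/m2 -/m3
  -/m4 -/m5; ring.
- apply: (eq0 _ _ _ (k * m5) Fe (rel (p e))); apply/rV3P; split; rewrite !mxE -/m1 -/m2 -/m3
  -/m4 -/m5; ring.
- by rewrite /k divfK ?subrr // mulf_neq0.
move=> [/subr0_eq-> /subr0_eq-> /subr0_eq-> /subr0_eq-> /subr0_eq->].
move=> [/subr0_eq-> /subr0_eq-> /subr0_eq-> /subr0_eq->].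
by split; split=> //; rewrite /k divfK // mulf_neq0.
Qed.

End K5.

(** * Stresses of a ring *)

Lemma big_quad (U : Type) (idx : U) (op : Monoid.com_law idx) (I : finType)
    (F : I * (bool * bool * bool) -> U) :
  \big[op/idx]_k F k =
  \big[op/idx]_i \big[op/idx]_b \big[op/idx]_s \big[op/idx]_t F (i, (b, s, t)).
Proof.
transitivity (\big[op/idx]_i \big[op/idx]_k F (i, k)).
  by rewrite pair_bigA; apply: eq_bigr => -[].
apply: eq_bigr => i _.
transitivity (\big[op/idx]_k \big[op/idx]_t F (i, (k, t))).
  by rewrite pair_bigA; apply: eq_bigr => -[].
by rewrite [RHS]pair_bigA; apply: eq_bigr => -[].
Qed.

Section ButterflyRing.
Variables (R : realType) (m : nat) (V : finType) (p : V -> 'rV[R]_3).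
Variable pt : 'I_m * option bool -> V.
Hypothesis m_ge3 : (3 <= m)%N.
Hypothesis pt_bij : bijective pt.
Hypothesis p_gp : general_position p.

Let pt_inj : injective pt := bij_inj pt_bij.

Lemma ordS_neq (i : 'I_m) : ordS i != i.
Proof.
apply/eqP => /(congr1 val) /=; have := ltn_ord i.
by rewrite leq_eqVlt => /predU1P[e|lt_iS]; rewrite ?e ?modnn ?(modn_small lt_iS); lia.
Qed.

Lemma ordSS_neq (i : 'I_m) : ordS (ordS i) != i.
Proof.
apply/eqP => /(congr1 val) /=; have := ltn_ord i.
rewrite leq_eqVlt => /predU1P[e|lt_iS]; first by rewrite e modnn modn_small; lia.
rewrite (modn_small lt_iS); move: lt_iS.
by rewrite leq_eqVlt => /predU1P[e|lt_iS]; rewrite ?e ?modnn ?(modn_small lt_iS); lia.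
Qed.

(* [(true, s, t)] is an edge between the two hinges of link [i], and
   [(false, s, t)] an edge from its apex to its hinge [i] or [ordS i]. *)
Definition ends (k : 'I_m * (bool * bool * bool)) :
    ('I_m * option bool) * ('I_m * option bool) :=
  let: (i, (b, s, t)) := k in
  if b then ((i, Some s), (ordS i, Some t))
  else ((i, None), (if s then ordS i else i, Some t)).

Definition ring_edge k : {set V} := [set pt (ends k).1; pt (ends k).2].
Definition ring_edges : {set {set V}} := [set ring_edge k | k in predT].
Definition hinge i : {set V} := [set pt (i, Some false); pt (i, Some true)].

Lemma ends_neq k : (ends k).1 != (ends k).2.
Proof.
case: k => i [[[] s] t]; rewrite /= xpair_eqE negb_and ?orbT //.
by rewrite eq_sym ordS_neq.
Qed.

Lemma set2_eq (T : finType) (x y u v : T) :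
  [set x; y] = [set u; v] -> x = u /\ y = v \/ x = v /\ y = u.
Proof.
move=> e; have := set22 x y; have := set21 x y; rewrite e !inE.
have := set22 u v; have := set21 u v; rewrite -e !inE.
by do 4![case/orP=> /eqP ?]; subst; auto.
Qed.

(** Two consecutive links share no edge because [ordS (ordS i)] differs from [i]; with two links,
    both would join the same two hinges. *)
Lemma ring_edge_inj : injective ring_edge.
Proof.
move=> [i [[b s] t]] [i' [[b' s'] t']] /set2_eq.
have S_inj := @ordS_inj m.
have nS := ordS_neq; have nSS := ordSS_neq.
case: b b' => -[] /= [] [/pt_inj e1 /pt_inj e2] //; move: e1 e2.
- by case=> -> -> [->].
- by case=> -> _ [/eqP]; rewrite (negbTE (nSS _)).
- case=> ->; case: s s' => -[] [] //=.
  + by move=> ->.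
  + by move/eqP; rewrite (negbTE (nS _)).
  + by move/eqP; rewrite eq_sym (negbTE (nS _)).
  + by move=> ->.
Qed.

Lemma card_ring_edges : #|ring_edges| = (8 * m)%N.
Proof.
by rewrite card_imset ?card_prod ?card_ord ?card_bool 1?mulnC //; exact: ring_edge_inj.
Qed.

Lemma card_ring_vertices : #|V| = (3 * m)%N.
Proof. by rewrite -(bij_eq_card pt_bij) card_prod card_ord card_option card_bool mulnC. Qed.

Lemma hinge_ring_edge i : hinge i \notin ring_edges.
Proof.
apply/imsetP => -[[j [[b s] t]] _ /set2_eq].
case: b => /= -[] [/pt_inj [e1 _] /pt_inj [e2 _]] //.
  by have := ordS_neq j; rewrite -e2 e1 eqxx.
by have := ordS_neq j; rewrite -e1 e2 eqxx.
Qed.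

Section Forces.
Variable x : 'I_m -> bool -> bool -> bool -> R.

Let P l := p (pt l).
Let A i := P (i, Some false).
Let B i := P (i, Some true).
Let E i := P (i, None).

(** The forces exerted by link [i] alone, at its hinge [i], at its hinge [ordS i] and at its apex,
    are kept apart in order to follow what one link transmits to the next. *)
Definition near_force i s : 'rV[R]_3 :=
  x i true s false *: (P (i, Some s) - A (ordS i))
  + x i true s true *: (P (i, Some s) - B (ordS i))
  + x i false false s *: (P (i, Some s) - E i).

Definition far_force i t : 'rV[R]_3 :=
  x i true false t *: (P (ordS i, Some t) - A i)
  + x i true true t *: (P (ordS i, Some t) - B i)
  + x i false true t *: (P (ordS i, Some t) - E i).

Definition apex_force i : 'rV[R]_3 :=
  x i false false false *: (E i - A i) + x i false false true *: (E i - B i)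
  + x i false true false *: (E i - A (ordS i)) + x i false true true *: (E i - B (ordS i)).

Definition ring_force v : 'rV[R]_3 :=
  \sum_k x k.1 k.2.1.1 k.2.1.2 k.2.2 *: force p (ring_edge k) v.

Lemma sum_delta (f : 'I_m -> 'rV[R]_3) i : \sum_j (i == j)%:R *: f j = f i.
Proof.
rewrite (bigD1 i) //= eqxx scale1r big1 ?addr0 // => j.
by rewrite eq_sym => /negbTE->; rewrite scale0r.
Qed.

Let ring_forceE l : ring_force (pt l) = \sum_i \sum_b \sum_s \sum_t
  x i b s t *: ((l == (ends (i, (b, s, t))).1)%:R *: (P (ends (i, (b, s, t))).1 - P (ends (i,
    (b, s, t))).2)
    + (l == (ends (i, (b, s, t))).2)%:R *: (P (ends (i, (b, s, t))).2 - P (ends (i, (b, s,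
      t))).1)).
Proof.
rewrite [LHS]big_quad; do 4![apply: eq_bigr => ? _].
by rewrite force_pair ?(inj_eq pt_inj) // ends_neq.
Qed.

Lemma ring_force_apex i : ring_force (pt (i, None)) = apex_force i.
Proof.
rewrite ring_forceE -sum_delta; apply: eq_bigr => j _.
by rewrite !big_bool /= !xpair_eqE !andbF ?andbT; apply/rV3P; split; rewrite /apex_force !mxE
  /=; ring.
Qed.

(** Exactly the links [i] and [ordS i] meet at hinge [ordS i]; this indexing avoids predecessors. *)
Lemma ring_force_hinge i s :
  ring_force (pt (ordS i, Some s)) = near_force (ordS i) s + far_force i s.
Proof.
rewrite ring_forceE -(sum_delta (near_force^~ s)) -(sum_delta (far_force^~ s)) -big_split /=.
apply: eq_bigr => j _.
by case: s; rewrite !big_bool /= !xpair_eqE !andbF ?andbT (inj_eq (@ordS_inj m));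
  apply/rV3P; split; rewrite /near_force /far_force !mxE /=; ring.
Qed.

End Forces.

Let P l := p (pt l).
Let A i := P (i, Some false).
Let B i := P (i, Some true).
Let E i := P (i, None).

Lemma ring_const (T : Type) (f : 'I_m -> T) :
  (forall i, f (ordS i) = f i) -> forall i j, f i = f j.
Proof.
move=> fS; suff f0 (i : 'I_m) : f i = f (Ordinal (leq_trans (isT : 0 < 3)%N m_ge3)).
  by move=> i j; rewrite (f0 i) (f0 j).
case: i => n; elim: n => [|n IHn] lt_nm; first by congr f; apply/val_inj.
rewrite -(IHn (ltnW lt_nm)) -[RHS]fS; congr f; apply/val_inj => /=.
by rewrite modn_small.
Qed.

Lemma link_uniq i : uniq [:: pt (i, Some false); pt (i, Some true);
  pt (ordS i, Some false); pt (ordS i, Some true); pt (i, None)].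
Proof.
by rewrite /= !inE !(inj_eq pt_inj) !xpair_eqE ![i == ordS i]eq_sym !(negbTE (ordS_neq i)) !andbF.
Qed.

(** The transmission factors [- far_coef / near_coef] do not multiply to 1 around the ring; products
    avoid the divisions. *)
Hypothesis coef_neq :
  \prod_i near_coef P i != (-1) ^+ m * \prod_i far_coef P i.

Lemma near_coef_neq0 i : near_coef P i != 0.
Proof. by have [m1 m2 _ _ _] := mu_neq0 p_gp (link_uniq i); apply: mulf_neq0. Qed.

(** All coefficients are nonzero, so one nonzero [x i] makes all of them nonzero. Multiplying the
    equations around the ring and cancelling the product of the [x i] contradicts [coef_neq]. *)
Lemma ring_system_inj (x : 'I_m -> R) :
  (forall i, x (ordS i) * near_coef P (ordS i) + x i * far_coef P i = 0) ->
  forall i, x i = 0.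
Proof.
move=> xE i; apply/eqP; apply: contraNT coef_neq => xi.
have x_const j : (x (ordS j) == 0) = (x j == 0) || (far_coef P j == 0).
  have := xE j; move/eqP; rewrite addr_eq0 => /eqP/(congr1 (fun y => y == 0)).
  by rewrite oppr_eq0 mulf_eq0 (negbTE (near_coef_neq0 _)) orbF mulf_eq0.
have t0 j : far_coef P j != 0.
  by have [_ _ m3 m4 _] := mu_neq0 p_gp (link_uniq j); apply: mulf_neq0.
have x_neq0 j : x j != 0.
  rewrite (ring_const (f := fun j => x j == 0) _ j i) // => k.
  by rewrite x_const (negbTE (t0 k)) orbF.
have prod_x : \prod_j x j != 0 by apply/prodf_neq0 => j _.
apply/eqP/(mulfI prod_x); rewrite mulrCA -!big_split /=.
rewrite (reindex_inj (@ordS_inj m)) /= -[X in (-1) ^+ X]card_ord -prodrN.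
by apply: eq_bigr => j _; apply/eqP; rewrite -addr_eq0 xE.
Qed.

Lemma ring_edges_stress w : stress p ring_edges w ->
  forall v, ring_force (fun i b s t => w (ring_edge (i, (b, s, t)))) v = 0.
Proof.
move=> wF v; rewrite -[RHS](wF v) big_imset /=; last by move=> ? ? _ _; apply: ring_edge_inj.
by apply: eq_bigr => -[i [[b s] t]].
Qed.

Lemma ring_independent (h : 'I_(3 + 3) -> 'I_m) :
  \det (hinge_lines P h) != 0 -> independent3 p ring_edges.
Proof.
move=> det_neq0; apply/independentP => w /ring_edges_stress.
set x := fun i b s t => w (ring_edge (i, (b, s, t))) => xF.
suff x0 : forall i b s t, x i b s t = 0.
  by move=> _ /imsetP[[i [[b s] t]] _ ->]; apply: x0.
have apex0 i : apex_force x i = 0 by rewrite -ring_force_apex.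
have farE i u : far_force x i u = - near_force x (ordS i) u.
  by apply/eqP; rewrite -addr_eq0 addrC -ring_force_hinge xF.
(* [F i] and [T i] are the force and the moment of the wrench of link [i] at its hinge [i]. Balance
   of the link and of the next hinge passes it on unchanged. *)
pose F i := near_force x i false + near_force x i true.
pose T i := cross (A i) (near_force x i false) + cross (B i) (near_force x i true).
have balance i := link_balance (A i) (B i) (A (ordS i)) (B (ordS i)) (E i)
  (x i true false false) (x i true false true) (x i false false false)
  (x i true true false) (x i true true true) (x i false false true)
  (x i false true false) (x i false true true).
have F_const i : F (ordS i) = F i.
  have [sum0 _] := balance i; rewrite -/(apex_force x i) apex0 addr0 in sum0.
  by apply/esym/eqP; rewrite -subr_eq0 /F opprD -!farE addrA; apply/eqP.
have T_const i : T (ordS i) = T i.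
  have [_ sum0] := balance i; rewrite -/(apex_force x i) apex0 crossv0 addr0 in sum0.
  by apply/esym/eqP; rewrite -subr_eq0 /T opprD -!crossvN -!farE addrA; apply/eqP.
(* By [moment_hinge] the common wrench is orthogonal to all hinge lines, six of which are
   independent. *)
have wrench0 i : row_mx (F i) (T i) = 0.
  have : row_mx (F i) (T i) *m (hinge_lines P h)^T = 0.
    apply/rowP => k; rewrite !mxE big_split_ord /=.
    rewrite (ring_const F_const i (h k)) (ring_const T_const i (h k)).
    rewrite -[RHS](moment_hinge (A (h k)) (B (h k)) (near_force x (h k) false)
      (near_force x (h k) true)); congr (_ + _); apply: eq_bigr => j _.
      by rewrite row_mxEl [_^T _ _]mxE hinge_linesE row_mxEl.
    by rewrite row_mxEr [_^T _ _]mxE hinge_linesE row_mxEr.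
  have lines_unit : (hinge_lines P h)^T \in unitmx by rewrite unitmx_tr unitmxE unitfE.
  by move=> e; rewrite -[LHS](mulmxK lines_unit) e mul0mx.
(* A zero wrench consists of two opposite forces along the hinge line, as if the missing hinge
   carried a stress [k i]. *)
have : forall i, exists k, near_force x i false = k *: (A i - B i)
    /\ near_force x i true = k *: (B i - A i).
  move=> i; move: (wrench0 i); rewrite -[0]row_mx0 => /eq_row_mx[F0 T0].
  have nearE : near_force x i true = - near_force x i false.
    by apply/eqP; rewrite -addr_eq0 addrC [_ + _]F0.
  have AB0 : A i - B i != 0.
    have [_ _ _ _] := mu_neq0 p_gp (link_uniq i); rewrite mu5E.
    by apply: contraNneq => AB0; rewrite /det3 [p _ - p _]AB0 !mxE !mul0r subrr addr0.
  have [|k kE] := cross_eq0_parallel AB0 (v := near_force x i false).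
    by rewrite -[RHS]T0 /T nearE; apply/rV3P; split; rewrite !mxE /= ?mxE; ring.
  by exists k; rewrite nearE kE -scalerN opprB.
case/fin_all_exists=> k kE.
(* With fictitious hinge stresses [- k i] and [k (ordS i)] the link is a stressed K5. The opposite
   signs at a shared hinge yield the system of [ring_system_inj]. *)
have K5E i := K5_stress p_gp (link_uniq i) (ab := - k i) (cd := k (ordS i))
  (ac := x i true false false) (ad := x i true false true) (ae := x i false false false)
  (bc := x i true true false) (bd := x i true true true) (be := x i false false true)
  (ce := x i false true false) (de := x i false true true).
have : forall i, exists y, [/\ k i = - (y * near_coef P i), k (ordS i) = y * far_coef P i
    & y = 0 -> forall b s t, x i b s t = 0].
  move=> i; have [near0 near1] := kE i; have [near0' near1'] := kE (ordS i).
  have := farE i true; have := farE i false; rewrite near0' near1' => far0 far1.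
  case: (K5E i).
  - rewrite -[RHS](subrr (near_force x i false)) [in X in _ = _ - X]near0.
    apply/rV3P; split; rewrite /near_force !mxE /A /B /E /P; ring.
  - rewrite -[RHS](subrr (near_force x i true)) [in X in _ = _ - X]near1.
    apply/rV3P; split; rewrite /near_force !mxE /A /B /E /P; ring.
  - rewrite -[RHS](subrr (far_force x i false)) [in X in _ = _ - X]far0.
    apply/rV3P; split; rewrite /far_force !mxE /A /B /E /P; ring.
  - rewrite -[RHS](apex0 i).
    apply/rV3P; split; rewrite /apex_force !mxE /A /B /E /P; ring.
  move=> y [[/eqP]]; rewrite eqr_oppLR => /eqP ky xac xad xae xbc [xbd xbe kSy xce xde].
  exists y; split=> // y0 [] [] []; rewrite /x in xac xad xae xbc xbd xbe xce xde *;
    by rewrite ?(xac, xad, xae, xbc, xbd, xbe, xce, xde) y0 mul0r.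
case/fin_all_exists=> y yE.
have y0 : forall i, y i = 0.
  apply: ring_system_inj => i; have [_ kS _] := yE i; have [kS' _ _] := yE (ordS i).
  by rewrite -kS kS' addrN.
by move=> i b s t; have [_ _] := yE i; apply; apply: y0.
Qed.

(** The system is square and has trivial kernel by [ring_system_inj]. *)
Lemma ring_system_onto i0 : exists x : 'I_m -> R, forall i,
  x (ordS i) * near_coef P (ordS i) + x i * far_coef P i = (ordS i == i0)%:R.
Proof.
pose M := \matrix_(i, j) ((i == j)%:R * near_coef P j + (ordS i == j)%:R * far_coef P i).
have mulE (u : 'rV_m) i : (u *m M) 0 (ordS i)
    = u 0 (ordS i) * near_coef P (ordS i) + u 0 i * far_coef P i.
  rewrite mxE; under eq_bigr => j _ do
    rewrite mxE mulrDr !mulrA ![u 0 j * _]mulrC -!mulrA.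
  rewrite big_split /= (bigD1 (ordS i)) //= eqxx mul1r big1 ?addr0 => [|j /negbTE->]; last first.
    by rewrite mul0r.
  congr (_ + _); rewrite (bigD1 i) //= eqxx mul1r big1 ?addr0 // => j.
  by rewrite (inj_eq (@ordS_inj m)) => /negbTE->; rewrite mul0r.
have Mfree : row_free M.
  apply: inj_row_free => u uM0; apply/rowP => i; rewrite mxE.
  by apply: (ring_system_inj (x := fun i => u 0 i)) => j; rewrite -mulE uM0 mxE.
have Munit : M \in unitmx by rewrite -row_free_unit.
exists (fun i => ((delta_mx 0 i0 : 'rV_m) *m invmx M) 0 i) => i.
by rewrite -mulE mulmxKV // mxE eqxx.
Qed.

Lemma hinge_circuit i0 : exists C : {set {set V}},
  [/\ C \subset hinge i0 |: ring_edges, hinge i0 \in C & circuit3 p C].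
Proof.
have [y yE] := ring_system_onto i0.
(* Link [i] carries [y i] times the stress of its K5, with the two hinges left out. *)
pose x i (b s t : bool) : R := y i * (
  let a := A i in let b' := B i in let c := A (ordS i) in let d := B (ordS i) in let e := E i in
  let m12 (s : bool) := if s then mu2 a b' c d e else mu1 a b' c d e in
  let m34 (s : bool) := if s then mu4 a b' c d e else mu3 a b' c d e in
  if b then m12 s * m34 t else mu5 a b' c d e * (if s then m34 t else m12 t)).
(* The added hinge has weight 1; the default 0 concerns only pairs that are neither this hinge nor
   ring edges. *)
pose w e := if e == hinge i0 then 1 else
  if [pick k | ring_edge k == e] is Some k then x k.1 k.2.1.1 k.2.1.2 k.2.2 else 0.
have wE v : \sum_(e in hinge i0 |: ring_edges) w e *: force p e v
    = force p (hinge i0) v + ring_force x v.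
  rewrite big_setU1 ?hinge_ring_edge //= {1}/w eqxx scale1r; congr (_ + _).
  rewrite big_imset /=; last by move=> ? ? _ _; apply: ring_edge_inj.
  apply: eq_bigr => k _; congr (_ *: _); rewrite /w ifN; last first.
    by apply: contraNneq (hinge_ring_edge i0) => <-; apply: imset_f.
  by case: pickP => [k' /eqP/ring_edge_inj->//|/(_ k)]; rewrite eqxx.
have rel i z := K5_relation (A i) (B i) (A (ordS i)) (B (ordS i)) (E i) z.
have apex0 i : apex_force x i = 0.
  rewrite -[RHS](scaler0 _ (y i * mu5 (A i) (B i) (A (ordS i)) (B (ordS i)) (E i))).
  rewrite -[in RHS](rel i (E i)); apply/rV3P; split; rewrite /apex_force /x !mxE -/(A i) -/(B
    i) -/(E i); ring.
have nearE i s : near_force x i s = (y i * near_coef P i) *: (if s then A i - B i else B i - A i).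
  pose z := if s then B i else A i.
  pose c := if s then mu2 (A i) (B i) (A (ordS i)) (B (ordS i)) (E i)
    else mu1 (A i) (B i) (A (ordS i)) (B (ordS i)) (E i).
  rewrite -[LHS]subr0 -(scaler0 _ (y i * c)) -(rel i z).
  by case: s @z @c; apply/rV3P; split; rewrite /near_force /x /near_coef !mxE -/(A i) -/(B i)
    -/(E i); ring.
have farE i s : far_force x i s
    = (y i * far_coef P i) *: (if s then A (ordS i) - B (ordS i) else B (ordS i) - A (ordS i)).
  pose z := if s then B (ordS i) else A (ordS i).
  pose c := if s then mu4 (A i) (B i) (A (ordS i)) (B (ordS i)) (E i)
    else mu3 (A i) (B i) (A (ordS i)) (B (ordS i)) (E i).
  rewrite -[LHS]subr0 -(scaler0 _ (y i * c)) -(rel i z).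
  by case: s @z @c; apply/rV3P; split; rewrite /far_force /x /far_coef !mxE -/(A i) -/(B i)
    -/(E i); ring.
have hinge_neq : pt (i0, Some false) != pt (i0, Some true).
  by rewrite (inj_eq pt_inj) xpair_eqE andbF.
have w_stress : stress p (hinge i0 |: ring_edges) w.
  move=> v; rewrite wE force_pair //.
  have [l ->] : exists l, v = pt l by have [g _ gK] := pt_bij; exists (g v); rewrite gK.
  case: l => i [s|]; rewrite !(inj_eq pt_inj) !xpair_eqE; last first.
    by rewrite !andbF !scale0r !add0r ring_force_apex apex0.
  (* The residual forces of the two links at a hinge add up to a multiple of the hinge vector. By
     [yE] it is nonzero only at [i0], where the added edge cancels it. *)
  rewrite -(ord_predK i) ring_force_hinge nearE farE -scalerDl yE.
  case: s; case: eqP => [->|_]; rewrite /= !scale0r ?scale1r ?addr0 ?add0r //.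
    by rewrite addrA subrK subrr.
  by rewrite addrA subrK subrr.
apply: (circuit_through (w := w)) w_stress _; first exact: setU11.
by rewrite /w eqxx oner_eq0.
Qed.

End ButterflyRing.

(** * Polynomial conditions satisfied by generic rings *)

Section GenericRing.
Variables (R : realType) (m : nat) (V : finType) (p : V -> 'rV[R]_3).
Variable pt : 'I_m * option bool -> V.
Hypothesis pt_bij : bijective pt.
Hypothesis p_gen : generic p.

Let vec (x y z : rat) : 'rV[rat]_3 := \row_k nth 0 [:: x; y; z] k.

(* With every hinge in the plane z = 0 and every apex at (0, 0, 1), [near_coef] and
   [far_coef] are up to sign products of areas of triangles of hinge vertices; the
   second vertex of hinge 0 is placed on the line of hinge 1. *)
Lemma generic_coef_neq : (3 <= m)%N ->
  \prod_i near_coef (p \o pt) i != (-1) ^+ m * \prod_i far_coef (p \o pt) i.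
Proof.
move=> m_ge3; rewrite -subr_eq0.
apply: (@generic_neq0 _ _ _ (fun A q => \prod_i near_coef (q \o pt) i
  - (-1) ^+ m * \prod_i far_coef (q \o pt) i)) p_gen _.
  move=> A B h q q' q'E; rewrite rmorphB rmorphM rmorphXn rmorphN1 !rmorph_prod /=.
  congr (_ - _ * _); apply: eq_bigr => i _; rewrite rmorphM /near_coef /far_coef /=;
  by rewrite !q'E; have [] := mu_map h (q (pt (i, Some false))) (q (pt (i, Some true)))
     (q (pt (ordS i, Some false))) (q (pt (ordS i, Some true))) (q (pt (i, None)));
     move=> e1 e2 e3 e4; rewrite ?(e1, e2, e3, e4).
have [g gK _] := pt_bij.
pose r (l : 'I_m * option bool) : 'rV[rat]_3 :=
  match l.2 with
  | Some false => vec (l.1 : nat)%:R 0 0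
  | Some true => if l.1 == 0%N :> nat then vec 1 1 0 else vec (l.1 : nat)%:R 2%:R 0
  | None => vec 0 0 1
  end.
exists (r \o g).
have rE l : ((r \o g) \o pt) l = r l by rewrite /= gK.
pose i0 := Ordinal (leq_trans (isT : 0 < 3)%N m_ge3).
have S0 : (1 %% m = 1)%N by rewrite modn_small ?(leq_trans _ m_ge3).
(* In link 0 the points [b], [c], [d] are collinear, so [mu1] and the whole near product vanish. It
   remains to see that no far coefficient does. *)
rewrite (bigD1 i0) //= [near_coef _ i0](_ : _ = 0); last first.
  rewrite /near_coef !rE /r /= S0 /mu1 /det3 !mxE /=; ring.
rewrite mul0r sub0r oppr_eq0 mulf_neq0 ?signr_eq0 //.
apply/prodf_neq0 => i _; rewrite /far_coef !rE /r /=.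
have [->|i_neq0] := eqVneq i i0.
  by rewrite S0 /= /mu3 /mu4 /det3 !mxE /=.
have i_pos : (i != 0 :> nat)%N by [].
have [lt_iS|le_mi] := ltnP i.+1 m.
  rewrite modn_small // (negbTE i_pos) /= /mu3 /mu4 /det3 !mxE /= -natr1.
  by apply: mulf_neq0; apply/eqP; lra.
have -> : i.+1 = m by apply/eqP; rewrite eqn_leq le_mi ltn_ord.
rewrite modnn (negbTE i_pos) /= /mu3 /mu4 /det3 !mxE /=.
(* The last link ends at hinge 0, and [i >= 2] keeps the point (1, 1, 0) off the line of hinge
   [i]. *)
have : (2 <= i)%N by rewrite -ltnS (leq_trans m_ge3).
rewrite -(ler_nat rat) => ?.
by apply: mulf_neq0; apply/eqP; lra.
Qed.

Lemma hinge_lines_map (A B : comNzRingType) (f : {rmorphism A -> B})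
    (q : 'I_m * option bool -> 'rV[A]_3) (q' : 'I_m * option bool -> 'rV[B]_3) h :
  (forall l, q' l = map_mx f (q l)) -> map_mx f (hinge_lines q h) = hinge_lines q' h.
Proof.
move=> q'E; apply/matrixP => k l; rewrite mxE !hinge_linesE !q'E -cross_map -map_mxB.
by rewrite -map_row_mx [RHS]mxE.
Qed.

(* The six edges of a tetrahedron have independent Pluecker vectors. *)
Lemma generic_hinge_lines : (6 <= m)%N ->
  exists h : 'I_(3 + 3) -> 'I_m, \det (hinge_lines (p \o pt) h) != 0.
Proof.
move=> m_ge6; pose h : 'I_(3 + 3) -> 'I_m := widen_ord m_ge6; exists h.
apply: (@generic_neq0 _ _ _ (fun A q => \det (hinge_lines (q \o pt) h))) p_gen _.
  move=> A B f q q' q'E; rewrite -det_map_mx; congr (\det _).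
  by apply: hinge_lines_map => l /=.
have [g gK _] := pt_bij.
(* Hinge [k] joins the [k]-th entries of the two lists, an edge of the tetrahedron on the origin and
   the unit vectors. *)
pose start := [:: vec 0 0 0; vec 0 0 0; vec 0 0 0; vec 1 0 0; vec 0 1 0; vec 0 0 1].
pose stop := [:: vec 1 0 0; vec 0 1 0; vec 0 0 1; vec 0 1 0; vec 0 0 1; vec 1 0 0].
pose r (l : 'I_m * option bool) : 'rV[rat]_3 := nth 0 (if l.2 == Some false then start else
  stop) l.1.
exists (r \o g); set M := hinge_lines _ h.
have ME k l : M k l = row_mx (cross (nth 0 start k) (nth 0 stop k)) (nth 0 stop k - nth 0 start
  k) 0 l.
  by rewrite /M hinge_linesE /= !gK.
suff : row_free M by rewrite row_free_unit unitmxE unitfE.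
apply: inj_row_free => v vM.
have c l : \sum_k v 0 k * M k l = 0.
  by have := congr1 (fun u : 'rV_(3 + 3) => u 0 l) vM; rewrite !mxE.
have cl j : \sum_k v 0 k * cross (nth 0 start k) (nth 0 stop k) 0 j = 0.
  by rewrite -[RHS](c (lshift 3 j)); apply: eq_bigr => k _; rewrite ME row_mxEl.
have cr j : \sum_k v 0 k * (nth 0 stop k - nth 0 start k) 0 j = 0.
  by rewrite -[RHS](c (rshift 3 j)); apply: eq_bigr => k _; rewrite ME row_mxEr.
have := (cl 0, cl 1, cl 2%:R, cr 0, cr 1, cr 2%:R).
rewrite !big_split_ord /= !sum3 !mxE /=.
case=> -[[[[e0 e1] e2] e3] e4] e5; apply/rowP => k; rewrite mxE.
by case: (split_ordP k) => j ->; case: (ord3E j) => ->; lra.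
Qed.

End GenericRing.

(** * The quotient graph of a ring *)

Section RingGraph.
Variables (m : nat) (L : 'I_m -> link).
Hypothesis L_butterfly : forall i, is_butterfly (L i).

Definition apex i : L i :=
  odflt (hinge_a (L i)) [pick y | y \notin [:: hinge_a (L i); hinge_b (L i); hinge_c (L i);
    hinge_d (L i)]].

(** Five vertices cannot all be among the four hinge vertices, so the default in [apex] is never
    reached. *)
Lemma apexP i : apex i \notin [:: hinge_a (L i); hinge_b (L i); hinge_c (L i); hinge_d (L i)].
Proof.
rewrite /apex; case: pickP => // all_in.
suff : (#|L i| <= 4)%N by have [->] := L_butterfly i.
rewrite -[4%N]/(size [:: hinge_a (L i); hinge_b (L i); hinge_c (L i); hinge_d (L i)]).
apply: leq_trans (card_size _); apply/subset_leq_card/subsetP => y _.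
by have /negbFE := all_in y.
Qed.

(* [Some (h, s)] is a vertex of the hinge (a, b) or (c, d) of link [i], and [None] its
   apex. *)
Definition link_point i (k : option (bool * bool)) : L i :=
  match k with
  | None => apex i
  | Some (false, false) => hinge_a (L i)
  | Some (false, true) => hinge_b (L i)
  | Some (true, false) => hinge_c (L i)
  | Some (true, true) => hinge_d (L i)
  end.

(** The second hinge of link [i] is named as the first hinge of link [ordS i], so glued vertices get
    equal labels. *)
Definition ring_label i (k : option (bool * bool)) : 'I_m * option bool :=
  if k is Some (h, s) then (if h then ordS i else i, Some s) else (i, None).

Lemma link_point_inj i : injective (link_point i).
Proof.
have := hinges_uniq (L i); have := apexP i; rewrite /= !inE !negb_or.
case/and4P=> ea eb ec ed /and4P[/and3P[ab ac ad] /andP[bc bd] cd _].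
by move=> [[[] []]|] [[[] []]|] //= /eqP;
  rewrite ?[_ == apex _]eq_sym ?(negbTE ea) ?(negbTE eb) ?(negbTE ec) ?(negbTE ed)
    1?[_ == hinge_a _]eq_sym ?(negbTE ab) ?(negbTE ac) ?(negbTE ad)
    1?[_ == hinge_b _]eq_sym ?(negbTE bc) ?(negbTE bd)
    1?[_ == hinge_c _]eq_sym ?(negbTE cd).
Qed.

Lemma link_point_onto i (x : L i) : exists k, x = link_point i k.
Proof.
have /codomP[k ->] : x \in codom (link_point i); last by exists k.
apply: inj_card_onto (@link_point_inj i) _ x.
by have [-> _] := L_butterfly i; rewrite card_option card_prod card_bool.
Qed.

Lemma butterfly_adj i k k' : adj (link_point i k) (link_point i k') =
  match k, k' with
  | None, None => false
  | Some (h, _), Some (h', _) => h != h'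
  | _, _ => true
  end.
Proof.
have set2E (T : finType) (x y u v : T) : ([set x; y] == [set u; v]) =
    [&& x \in [set u; v], y \in [set u; v], u \in [set x; y] & v \in [set x; y]].
  by rewrite eqEsubset !subUset !sub1set -andbA.
have [_ ->] := L_butterfly i.
rewrite -[hinge_a _]/(link_point i (Some (false, false))).
rewrite -[hinge_b _]/(link_point i (Some (false, true))).
rewrite -[hinge_c _]/(link_point i (Some (true, false))).
rewrite -[hinge_d _]/(link_point i (Some (true, true))).
rewrite !set2E !inE !(inj_eq (@link_point_inj i)).
by case: k k' => [[[] []]|] [[[] []]|].
Qed.

Definition label (u : link_vertex L) : 'I_m * option bool :=
  if [pick k | link_point (tag u) k == tagged u] is Some k then ring_label (tag u) k
  else (tag u, None).

Lemma labelE i k : label (in_link (link_point i k)) = ring_label i k.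
Proof.
rewrite /label; case: pickP => [k' /eqP/link_point_inj->//|/(_ k)].
by rewrite eqxx.
Qed.

Definition ring_rel := relU (glue (L := L)) (fun x y => glue y x).

Lemma ring_rel_sym : connect_sym ring_rel.
Proof. by apply: sym_connect_sym => x y; rewrite /ring_rel /= orbC. Qed.

(** Labels are invariant under gluing, hence vertices with different labels stay distinct in the
    quotient. *)
Lemma label_connect u v : connect ring_rel u v -> label u = label v.
Proof.
have label_glue x y : glue x y -> label x = label y.
  case/existsP=> i /orP[] /andP[/eqP-> /eqP->].
    exact: etrans (labelE i (Some (true, false))) (esym (labelE (ordS i) (Some (false, false)))).
  exact: etrans (labelE i (Some (true, true))) (esym (labelE (ordS i) (Some (false, true)))).
case/connectP=> s; elim: s u => [u _ ->//|w s IHs u /= /andP[uw]] /IHs IH /IH <-.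
by case/orP: uw => /label_glue.
Qed.

Definition ring_point (l : 'I_m * option bool) : ring_graph L :=
  to_ring (link_point l.1 (omap (pair false) l.2)).

Lemma to_ringP i j (x : L i) (y : L j) :
  to_ring x = to_ring y <-> connect ring_rel (in_link x) (in_link y).
Proof.
split=> [/(congr1 val)/= /setP/(_ (in_link y))|xy].
  by rewrite !inE connect0; apply.
apply/val_inj/setP => z /=; rewrite !inE.
exact: same_connect ring_rel_sym _ _ xy z.
Qed.

Lemma to_ring_point i k : to_ring (link_point i k) = ring_point (ring_label i k).
Proof.
case: k => [[[] s]|] //.
apply/to_ringP/connect1/orP; left; apply/existsP; exists i.
by case: s; apply/orP; [right|left]; apply/andP.
Qed.

Lemma label_point l : label (in_link (link_point l.1 (omap (pair false) l.2))) = l.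
Proof. by rewrite labelE; case: l => i []. Qed.

Lemma ring_point_bij : bijective ring_point.
Proof.
have inj : injective ring_point.
  by move=> l l' /to_ringP/label_connect; rewrite !label_point.
have onto (v : ring_graph L) : exists l, ring_point l == v.
  case: v => B /[dup] /codomP[[i x] ->] Bv; have [k xE] := link_point_onto x.
  exists (ring_label i k); rewrite -to_ring_point -xE; apply/eqP/val_inj.
  by [].
exists (fun v => xchoose (onto v)) => [l|v]; last exact/eqP/(xchooseP (onto v)).
by apply/inj/eqP/(xchooseP (onto _)).
Qed.

Lemma to_ring_c i : to_ring (hinge_c (L i)) = ring_point (ordS i, Some false).
Proof. exact: to_ring_point i (Some (true, false)). Qed.

Lemma to_ring_d i : to_ring (hinge_d (L i)) = ring_point (ordS i, Some true).
Proof. exact: to_ring_point i (Some (true, true)). Qed.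

Lemma ring_graph_edges : (3 <= m)%N -> edges (ring_graph L) = ring_edges ring_point.
Proof.
move=> m_ge3; apply/setP => e; rewrite inE; apply/existsP/imsetP.
  case=> u /existsP[v /andP[/andP[_ /existsP[i /existsP[x /existsP[y /and3P[xy /eqP<-
    /eqP<-]]]]] /eqP->]].
  have [k xE] := link_point_onto x; have [k' yE] := link_point_onto y.
  move: xy; rewrite {}xE {}yE butterfly_adj !to_ring_point.
  case: k k' => [[h s]|] [[h' s']|] //=.
  - case: h h' => -[] // _; last by exists (i, (true, s, s')).
    by exists (i, (true, s', s)) => //; rewrite setUC.
  - by exists (i, (false, h, s)) => //; rewrite setUC.
  - by exists (i, (false, h', s')).
case=> -[i [[b s] t]] _ ->.
exists (ring_point (ends (i, (b, s, t))).1); apply/existsP.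
exists (ring_point (ends (i, (b, s, t))).2); rewrite eqxx andbT.
apply/andP; split; first by rewrite (inj_eq (bij_inj ring_point_bij)) ends_neq.
apply/existsP; exists i; case: b => /=.
  apply/existsP; exists (link_point i (Some (false, s))).
  apply/existsP; exists (link_point i (Some (true, t))).
  by rewrite butterfly_adj !to_ring_point !eqxx.
apply/existsP; exists (link_point i None).
apply/existsP; exists (link_point i (Some (s, t))).
by rewrite butterfly_adj !to_ring_point !eqxx.
Qed.

End RingGraph.

(** * Edges spanned in a ring *)

Definition chain_states : seq (nat * nat * nat) :=
  [:: (0, 0, 0); (1, 0, 3); (1, 1, 3); (2, 0, 5); (2, 0, 6); (2, 1, 5); (2, 1, 6);
      (2, 2, 6); (3, 0, 6); (3, 1, 6)]%N.

(* [chain_states] lists the values below 7 of the defect (3 * vertices - edges),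
   together with the number of vertices and the size of the last hinge, over the
   induced subgraphs of an open chain of links that avoid its first hinge. *)
Lemma chain_count m (h e : nat -> nat) :
  (forall n, h n <= 2)%N -> (forall n, e n <= 1)%N -> h 0%N = 0%N ->
  (5 <= \sum_(n < m) (e n + h n.+1))%N ->
  (\sum_(n < m) (h n * h n.+1 + e n * (h n + h n.+1)) + 7 <=
   3 * \sum_(n < m) (e n + h n.+1))%N.
Proof.
move=> h2 e1 h0.
pose N m := (\sum_(n < m) (e n + h n.+1))%N.
pose Q m := (\sum_(n < m) (h n * h n.+1 + e n * (h n + h n.+1)))%N.
suff [D DE D7] : exists2 D, (3 * N m = Q m + D)%N & (7 <= D)%N || ((N m, h m, D) \in
  chain_states).
  rewrite -/(N m) -/(Q m) DE leq_add2l => N5; case/orP: D7 => // stD.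
  have /allP/(_ _ stD) : all (fun st => st.1.1 < 5)%N chain_states by [].
  by rewrite ltnNge N5.
elim: m => [|m [D DE DP]]; first by exists 0%N; rewrite /N /Q ?big_ord0 ?h0.
(* Three per new vertex minus the new edges. With [h <= 2] and [e <= 1] the increment is never
   negative, so the subtraction is not truncated and a defect of at least 7 persists. *)
exists (D + (3 * e m + 3 * h m.+1 - h m * h m.+1 - e m * (h m + h m.+1)))%N.
  rewrite /N /Q !big_ord_recr /= -/(N m) -/(Q m).
  have := h2 m; have := h2 m.+1; have := e1 m; nia.
case/orP: DP => [D7|stD]; first by rewrite ltn_addr.
have -> : N m.+1 = (N m + (e m + h m.+1))%N by rewrite /N big_ord_recr.
have := h2 m.+1; have := e1 m; move: (e m) (h m.+1) => e' h' e'1 h'2.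
(* A finite check: every listed state under each of the six choices of [e'] and [h']. *)
suff /allP/(_ _ stD) : all (fun st : nat * nat * nat => let: (n, k, d) := st in
    let d' := (d + (3 * e' + 3 * h' - k * h' - e' * (k + h')))%N in
    (7 <= d')%N || ((n + (e' + h'), h', d')%N \in chain_states)) chain_states by [].
by case: e' h' e'1 h'2 => [|[|?]] [|[|[|?]]].
Qed.

Lemma iter_ordS m (j : 'I_m) n : val (iter n (@ordS m) j) = ((j + n) %% m)%N.
Proof.
elim: n => [|n IHn] /=; first by rewrite addn0 modn_small.
by rewrite [X in X.+1]IHn -addn1 modnDml addn1 addnS.
Qed.

(** If every hinge is occupied, each link contributes at least 1 to the defect, which is then at
    least [m]. Otherwise the ring is cut open at an empty hinge and [chain_count] applies. *)
Lemma ring_count m (h e : 'I_m -> nat) : (7 <= m)%N ->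
  (forall i, h i <= 2)%N -> (forall i, e i <= 1)%N -> (5 <= \sum_i (e i + h i))%N ->
  (\sum_i (h i * h (ordS i) + e i * (h i + h (ordS i))) + 7 <= 3 * \sum_i (e i + h i))%N.
Proof.
move=> m7 h2 e1 N5.
have [/existsP[j /eqP hj0]|/existsPn h_pos] := boolP [exists j, h j == 0%N]; last first.
  (* The count is doubled so that each link can take half of each of its two hinges. *)
  have sum_local : (\sum_i (2 * (h i * h (ordS i) + e i * (h i + h (ordS i))) + 2)
      <= \sum_i (6 * e i + 3 * h i + 3 * h (ordS i)))%N.
    apply: leq_sum => i _; have := h2 i; have := h2 (ordS i); have := e1 i.
    have := h_pos i; have := h_pos (ordS i); rewrite -!lt0n.
    by case: (e i) (h i) (h (ordS i)) => [|[|?]] [|[|[|?]]] [|[|[|?]]].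
  move: sum_local; rewrite !big_split /= !big1_eq sum_nat_const card_ord.
  have <- : (\sum_i h i = \sum_i h (ordS i))%N by rewrite [LHS](reindex_inj (@ordS_inj m)).
  move: (\sum_i e i)%N (\sum_i h i)%N (\sum_i h i * h (ordS i))%N
    (\sum_i e i * (h i + h (ordS i)))%N => a b c d. lia.
have shift (f : 'I_m -> nat) : (\sum_i f i = \sum_(n < m) f (iter n (@ordS m) j))%N.
  rewrite (reindex_inj (h := fun n : 'I_m => iter n (@ordS m) j)) //= => n n' /(congr1 val).
  rewrite !iter_ordS => /eqP; rewrite eqn_modDl !modn_small // => /eqP/val_inj.
  exact.
have shiftS (f : 'I_m -> nat) : (\sum_i f i = \sum_(n < m) f (iter n.+1 (@ordS m) j))%N.
  by rewrite (reindex_inj (@ordS_inj m)) shift.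
(* Starting at the empty hinge [j], each step counts an apex and the following hinge; the last step
   returns to [j]. *)
have sumE : (\sum_i (e i + h i) = \sum_(n < m) (e (iter n (@ordS m) j) + h (iter n.+1 (@ordS m)
  j)))%N.
  by rewrite !big_split /= -shift -shiftS.
rewrite shift; move: N5; rewrite sumE => N5.
exact: (chain_count (h := fun n => h (iter n (@ordS m) j)) (e := fun n => e (iter n (@ordS m)
  j))).
Qed.

(** With [h i] and [e i] the numbers of vertices of [W] on hinge [i] and at apex [i], the summands
    of [ring_count] bound the edges spanned in each link. *)
Lemma ring_sparse m (V : finType) (pt : 'I_m * option bool -> V)
    (W : {set V}) (F : {set {set V}}) : bijective pt -> (7 <= m)%N ->
  F \subset ring_edges pt -> F \subset complete_edges W -> (5 <= #|W|)%N ->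
  (#|F| + 7 <= 3 * #|W|)%N.
Proof.
move=> pt_bij m7 FE FW.
pose chi l : nat := pt l \in W.
pose h i := (chi (i, Some false) + chi (i, Some true))%N.
pose e i := chi (i, None).
have cardW : (#|W| = \sum_i (e i + h i))%N.
  rewrite -sum1_card big_mkcond (reindex pt) /=; last exact: onW_bij.
  transitivity (\sum_i \sum_o chi (i, o))%N.
    by rewrite pair_bigA; apply: eq_bigr => -[i o] _ /=; rewrite /chi; case: (_ \in W).
  apply: eq_bigr => i _; rewrite (bigD1 None) //=; congr (_ + _)%N.
  rewrite (bigD1 (Some false)) //= (bigD1 (Some true)) //= big1 ?addn0 // => -[[]|] //.
have cardF : (#|F| <= \sum_i (h i * h (ordS i) + e i * (h i + h (ordS i))))%N.
  pose K := [set k | (pt (ends k).1 \in W) && (pt (ends k).2 \in W)].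
  have FK : F \subset [set ring_edge pt k | k in K].
    apply/subsetP => f fF; have /imsetP[k _ fE] := subsetP FE f fF.
    rewrite fE imset_f // inE; have := subsetP FW f fF.
    by rewrite inE fE subUset !sub1set => /andP[].
  apply: leq_trans (subset_leq_card FK) (leq_trans (leq_imset_card _ _) _).
  rewrite -sum1_card big_mkcond big_quad; apply: leq_sum => i _.
  rewrite !big_bool !inE /= /h /e /chi.
  by do 5![case: (_ \in W)].
rewrite cardW => W5; apply: leq_trans (ring_count m7 _ _ W5); first by rewrite leq_add2r.
  by move=> i; rewrite /h /chi; do 2![case: (_ \in W)].
by move=> i; rewrite /e /chi; case: (_ \in W).
Qed.

Theorem theorem1 (R : realType) (m : nat) (L : 'I_m -> link)
    (p : ring_graph L -> 'rV[R]_3) :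
  (3 <= m)%N ->
  (forall i, is_butterfly (L i)) ->
  generic p ->
  [/\ forall i : 'I_m,
        implied_nonedge p (to_ring (hinge_a (L i))) (to_ring (hinge_b (L i))) /\
        implied_nonedge p (to_ring (hinge_c (L i))) (to_ring (hinge_d (L i))),
      (7 <= m)%N -> nucleation_free p,
      (6 <= m)%N -> independent3 p (edges (ring_graph L)) /\
                    independent_flexes p = m%:Z - 6
    & (m <= 5)%N -> dependent3 p (edges (ring_graph L))].
Proof.
move=> m_ge3 L_butterfly p_gen.
have pt_bij := ring_point_bij L_butterfly.
have pt_inj := bij_inj pt_bij.
have p_gp := generic_general_position p_gen.
have coef_neq := generic_coef_neq pt_bij p_gen m_ge3.
have edgesE := ring_graph_edges L_butterfly m_ge3.
have cardV : #|ring_graph L| = (3 * m)%N := card_ring_vertices pt_bij.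
have cardE : #|edges (ring_graph L)| = (8 * m)%N.
  by rewrite edgesE card_ring_edges.
have V4 : (4 <= #|ring_graph L|)%N by rewrite cardV; lia.
have indep : (6 <= m)%N -> independent3 p (edges (ring_graph L)).
  move=> m6; rewrite edgesE; have [h det_h] := generic_hinge_lines pt_bij p_gen m6.
  exact: ring_independent det_h.
have hinge_implied i : implied_nonedge p (ring_point L (i, Some false)) (ring_point L (i, Some
  true)).
  have hinge_edge := hinge_ring_edge m_ge3 pt_bij i.
  split.
  - by rewrite (inj_eq pt_inj) xpair_eqE andbF.
  - apply: contra hinge_edge => adj_ab; rewrite -edgesE inE.
    by apply/existsP; exists (ring_point L (i, Some false));
      apply/existsP; exists (ring_point L (i, Some true)); rewrite adj_ab eqxx.
  - have [C [CE hC circC]] := hinge_circuit m_ge3 pt_bij p_gp coef_neq i.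
    by exists C; split=> //; rewrite edgesE setUC.
split.
- by move=> i; rewrite to_ring_c ?to_ring_d //; split; apply: hinge_implied.
(* Being independent and rigid, [F] would have at least [3 * #|W| - 6] edges, one more than
   [ring_sparse] allows. *)
- move=> m7 W F [[/subsetIP[FE FW] rankF] W5].
  have Find : independent3 p F by apply: independentS FE (indep (ltnW m7)).
  have := rank_complete_edges p_gp V4 (ltnW (ltnW W5)).
  have FE' := FE; rewrite edgesE in FE'.
  rewrite -rankF Find => /(leq_trans (ring_sparse pt_bij m7 FE' FW W5)).
  by rewrite leq_add2l.
- move=> m6; have ind := indep m6; split=> //.
  rewrite /independent_flexes ind cardV cardE; lia.
(* Independence would force [8 * m + 6 <= 9 * m], that is [m >= 6]. *)
- move=> m5 ind.
  have E2 : {in edges (ring_graph L), forall e : {set ring_graph L}, #|e| = 2}.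
    move=> e; rewrite inE => /existsP[u /existsP[v /andP[uv /eqP->]]].
    by rewrite cards2; case: eqP uv => // ->; rewrite adj_irrefl.
  by have := rank_le p_gp V4 E2; rewrite ind cardE cardV; lia.
Qed.
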